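(* Let $\ell\in\mathbb N^*$. Let $\mathbf p$ be an offspring distribution with $\mathbf p(0)+\mathbf p(1)<1$, with $\mathbf p(0)=0$, finite mean, and admitting a moment of order $\ell$, and let $\mathbf q$ be a mark function such that $\mathbf p(k)\mathbf q(k)>0$ for some $k\in\mathbb N$. Let $\mathbb P$ be the distribution of the marked Galton-Watson tree with offspring distribution $\mathbf p$ and mark function $\mathbf q$. Let $r=\min\{k\in\mathbb N:\mathbf p(k)>0\}$, $s\in(0,1)$, $t\in(0,1]$, and $\alpha_r(s)=\mathbf p(r)(s\mathbf q(r)+1-\mathbf q(r))$. Set $$B_{s,n,0,r}=\begin{cases}s^{M_n}\alpha_1(s)^{-n}\mathbf 1_{Z_n=1}&\text{if }r=1,\\ s^{M_n}\alpha_r(s)^{-\frac{r^n-1}{r-1}}\mathbf 1_{Z_n=r^n}&\text{if }r>1.\end{cases}$$ (1) For all $n\in\mathbb N$ and $\Lambda_n\in\mathscr F_n$, $$\frac{\mathbb E[\mathbf 1_{\Lambda_n}H_\ell(Z_{n+p})s^{M_{n+p}}t^{Z_{n+p}}]}{\mathbb E[H_\ell(Z_{n+p})s^{M_{n+p}}t^{Z_{n+p}}]}\underset{p\to+\infty}{\longrightarrow}\mathbb E[\mathbf 1_{\Lambda_n}B_{s,n,0,r}].$$ (2) The probability measure $\mathbb Q_{s,0,r}$ on $(\mathbb T^*,\mathscr F)$ defined by $\mathbb Q_{s,0,r}(\Lambda_n)=\mathbb E[\mathbf 1_{\Lambda_n}B_{s,n,0,r}]$ for all $n\in\mathbb N$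 and $\Lambda_n\in\mathscr F_n$ is the distribution of the regular $r$-ary tree (every node has exactly $r$ children) in which each node is marked, independently of the others, with probability $$\frac{s\mathbf q(r)}{s\mathbf q(r)+1-\mathbf q(r)}.$$
   Context: $\mathbb N=\{0,1,2,\dots\}$, $\mathbb N^*=\{1,2,\dots\}$. Let $\mathscr U=\bigcup_{n\ge0}(\mathbb N^* )^n$ be the set of finite sequences of positive integers, $|u|$ the length of $u$, $\emptyset$ the empty sequence. A tree $\mathbf t$ is a subset of $\mathscr U$ such that $\emptyset\in\mathbf t$; $uj\in\mathbf t\Rightarrow u\in\mathbf t$ (for $j\in\mathbb N^*$); and for each $u\in\mathbf t$ there is $k_u(\mathbf t)\in\mathbb N$ with $ui\in\mathbf t\iff i\le k_u(\mathbf t)$. A marked tree is $\mathbf t^*=(\mathbf t,(\eta_u)_{u\in\mathbf t})$ with $\eta_u\in\{0,1\}$; $\mathbb T^*$ is the set of marked trees. For $n\in\mathbb N$, $r_n^*(\mathbf t^* )$ is the marked tree consisting of the nodes $u\in\mathbf t$ with $|u|\le n$, keeping the marks of nodes with $|u|\le n-1$ and setting the marks at level $n$ to $0$. $\mathscr F_n$ is the $\sigma$-field on $\mathbb T^*$ generated by $r_n^*$, and $\mathscr F=\bigvee_n\mathscr F_n$. $Z_n(\mathbf t^* )$ is the number of nodes $u\in\mathbf t$ with $|u|=n$; $M_0=0$ and $M_n(\mathbf t^* )=\sum_{u\in\mathbf t,|u|\le n-1}\eta_u$ for $n\ge1$. An offspring distribution is a probability distribution $\mathbf p$ on $\mathbb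 N$; a mark function is a map $\mathbf q:\mathbb N\to[0,1]$. Set $\mathbf p_0(k,1)=\mathbf p(k)\mathbf q(k)$, $\mathbf p_0(k,0)=\mathbf p(k)(1-\mathbf q(k))$. The marked Galton-Watson tree distribution $\mathbb P$ is the unique probability measure on $(\mathbb T^*,\mathscr F)$ such that, with $\tau^*$ the identity map of $\mathbb T^*$, for all $h\ge1$ and $\mathbf t^*\in\mathbb T^*$, $\mathbb P(r_h^*(\tau^* )=r_h^*(\mathbf t^* ))=\prod_{u\in\mathbf t,|u|\le h-1}\mathbf p_0(k_u(\mathbf t),\eta_u)$. $\mathbb E$ is the expectation under $\mathbb P$, and $Z_n=Z_n(\tau^* )$, $M_n=M_n(\tau^* )$. $H_\ell(x)=\frac1{\ell!}\prod_{j=0}^{\ell-1}(x-j)$ for $\ell\ge1$. The quotient is considered for $p$ large enough that its denominator is nonzero. *)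

(* Defs.v *)
From HB Require Import structures.
From mathcomp Require Import all_boot all_order all_algebra.
From mathcomp Require Import finmap.
From mathcomp Require Import all_classical all_reals all_analysis.

Set Implicit Arguments.
Unset Strict Implicit.
Unset Printing Implicit Defensive.

Import Order.TTheory GRing.Theory Num.Theory.
Import numFieldNormedType.Exports.

Local Open Scope classical_set_scope.
Local Open Scope ring_scope.

(* A node is a finite sequence of positive integers; its child number j is
   [rcons u j], so that children are numbered from 1. *)
Definition is_tree (t : set (seq nat)) : Prop :=
  [/\ forall u, t u -> all (fun j => (0 < j)%N) u,
      t [::],
      forall u j, t (rcons u j) -> t u &
      forall u, t u -> exists k, forall i, (0 < i)%N ->
        (t (rcons u i) <-> (i <= k)%N)].

(* Marks are only meaningful on the nodes: [mark] is required to vanish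
   elsewhere so that equality of marked trees is the intended one. *)
Record markedTree := MarkedTree {
  nodes : set (seq nat);
  mark : seq nat -> bool;
  nodes_tree : is_tree nodes;
  mark_nodes : forall u, mark u -> nodes u }.

Definition kids (t : markedTree) (u : seq nat) : nat :=
  xget 0%N [set k | forall i, (0 < i)%N ->
    (nodes t (rcons u i) <-> (i <= k)%N)].

Lemma kidsP (t : markedTree) (u : seq nat) : nodes t u ->
  forall i, (0 < i)%N -> (nodes t (rcons u i) <-> (i <= kids t u)%N).
Proof.
move=> tu; case: (nodes_tree t) => _ _ _ /(_ u tu) exk.
exact: (xgetPex 0%N exk).
Qed.

Lemma is_tree_dot : is_tree [set [::]].
Proof.
split => //.
- by move=> u ->.
- by move=> [|? ?] j.
- move=> u ->; exists 0%N => -[|i] // _; split => //.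
Qed.

Definition dot : markedTree.
Proof. by refine (@MarkedTree [set [::]] (fun=> false) is_tree_dot _). Defined.

Lemma is_tree_trunc (n : nat) (t : set (seq nat)) : is_tree t ->
  is_tree [set u | t u /\ (size u <= n)%N].
Proof.
case=> tpos t0 tpar tkids; split => //=.
- by move=> u [/tpos].
- by move=> u j [/tpar tu]; rewrite size_rcons => /ltnW.
- move=> u [tu un]; have [k kP] := tkids u tu.
  have [ltun|lenu] := ltnP (size u) n.
    exists k => i i0; rewrite size_rcons ltun -kP//; split => [[]|] //.
  exists 0%N => i i0; rewrite size_rcons ltnNge lenu; split => [[]|] //.
  by rewrite leqNgt i0.
Qed.

Lemma trunc_mark_nodes (n : nat) (t : markedTree) (u : seq nat) :
  mark t u && (size u < n)%N ->
  [set v | nodes t v /\ (size v <= n)%N] u.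
Proof. by case/andP => /mark_nodes tu /ltnW. Qed.

Definition rstar (n : nat) (t : markedTree) : markedTree :=
  MarkedTree (is_tree_trunc n (nodes_tree t)) (@trunc_mark_nodes n t).

Definition level (t : markedTree) (n : nat) : set (seq nat) :=
  [set u | nodes t u /\ size u = n].

Definition below (t : markedTree) (n : nat) : set (seq nat) :=
  [set u | nodes t u /\ (size u < n)%N].

(* [fset_set] sends infinite sets to the empty one; these two lemmas show that
   this never occurs for the node sets used below. *)
Lemma finite_level (t : markedTree) (n : nat) : finite_set (level t n).
Proof.
elim: n => [|n IHn].
  apply: (@sub_finite_set _ _ [set [::]]) => // u [_ /size0nil -> //].
apply: (@sub_finite_set _ _
  (\bigcup_(u in level t n) (rcons u @` `I_(kids t u).+1))).
  move=> v; case/lastP: v => [[]//|u i] [tui]; rewrite size_rcons => -[un].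
  case: (nodes_tree t) => tpos _ tpar _; have tu := tpar _ _ tui.
  exists u => //; exists i => //=; rewrite ltnS.
  apply/(kidsP tu) => //.
  by have := tpos _ tui; rewrite all_rcons => /andP[].
apply: bigcup_finite => // u _; apply: finite_image; exact: finite_II.
Qed.

Lemma finite_below (t : markedTree) (n : nat) : finite_set (below t n).
Proof.
apply: (@sub_finite_set _ _ (\bigcup_(k in `I_n) level t k)).
  by move=> u [tu un]; exists (size u).
by apply: bigcup_finite => [|k _]; [exact: finite_II | exact: finite_level].
Qed.

Definition Zn (n : nat) (t : markedTree) : nat := #|` fset_set (level t n)|%fset.

Definition Mn (n : nat) (t : markedTree) : nat :=
  (\sum_(u <- fset_set (below t n)) mark t u)%N.

HB.instance Definition _ := gen_eqMixin markedTree.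
HB.instance Definition _ := gen_choiceMixin markedTree.
HB.instance Definition _ := isPointed.Build markedTree dot.

(* The sigma-field generated by r_n^*: since nodes have finitely many children,
   r_n^* takes countably many values, and all sets of values are measurable. *)
Definition Fn (n : nat) : set (set markedTree) :=
  preimage_set_system setT (rstar n) setT.

Definition Fgen : set (set markedTree) := \bigcup_n Fn n.

HB.instance Definition _ := @isMeasurable.Build default_measure_display
  markedTree <<s Fgen >> (@sigma_algebra0 _ setT Fgen) (@sigma_algebraC _ Fgen)
  (@sigma_algebra_bigcup _ setT Fgen).

Definition is_offspring (R : realType) (p : nat -> R) : Prop :=
  (forall k, 0 <= p k) /\ (\sum_(0 <= k <oo) (p k)%:E = 1)%E.

Definition has_moment (R : realType) (p : nat -> R) (l : nat) : Prop :=
  (\sum_(0 <= k <oo) (k%:R ^+ l * p k)%:E < +oo)%E.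

Definition is_mark_function (R : realType) (q : nat -> R) : Prop :=
  forall k, 0 <= q k <= 1.

Definition p0 (R : realType) (p q : nat -> R) (k : nat) (eta : bool) : R :=
  if eta then p k * q k else p k * (1 - q k).

Definition is_marked_GW (R : realType) (p q : nat -> R)
    (P : probability markedTree R) : Prop :=
  forall (h : nat) (t : markedTree), (0 < h)%N ->
    P [set tau | rstar h tau = rstar h t] =
    (\prod_(u <- fset_set (below t h)) p0 p q (kids t u) (mark t u))%:E.

Definition Hpoly (R : realType) (l : nat) (x : R) : R :=
  (l`!%:R)^-1 * \prod_(j < l) (x - j%:R).

Definition alpha (R : realType) (p q : nat -> R) (r : nat) (s : R) : R :=
  p r * (s * q r + 1 - q r).

(* The division in the exponent is exact. *)
Definition Bmart (R : realType) (p q : nat -> R) (s : R) (n r : nat)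
    (tau : markedTree) : R :=
  if r == 1%N then
    s ^+ Mn n tau * alpha p q 1 s ^- n * \1_[set t | Zn n t = 1%N] tau
  else
    s ^+ Mn n tau * alpha p q r s ^- ((r ^ n - 1) %/ (r - 1))%N
      * \1_[set t | Zn n t = (r ^ n)%N] tau.

Definition defines_Q (R : realType) (P : probability markedTree R)
    (p q : nat -> R) (s : R) (r : nat) (Q : probability markedTree R) : Prop :=
  forall n (L : set markedTree), Fn n L ->
    Q L = 'E_P[fun tau => (\1_L tau * Bmart p q s n r tau)%R]%E.

Definition independent_events d (T : measurableType d) (R : realType)
    (P : probability T R) (I : choiceType) (D : set I) (E : I -> set T) : Prop :=
  (forall i, D i -> measurable (E i)) /\
  (forall J : {fset I}, [set` J] `<=` D ->
    P (\bigcap_(i in [set` J]) E i) = (\prod_(i <- J) P (E i))%E).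

Definition regular_tree (r : nat) : set (seq nat) :=
  [set u | all (fun j => (0 < j <= r)%N) u].

(* Q is the distribution of the r-ary tree whose nodes are marked independently
   with probability a. *)
Definition is_marked_regular_tree (R : realType) (r : nat) (a : R)
    (Q : probability markedTree R) : Prop :=
  [/\ {ae Q, forall tau, nodes tau = regular_tree r},
      forall u, regular_tree r u -> Q [set tau | mark tau u] = a%:E &
      independent_events Q (regular_tree r) (fun u => [set tau | mark tau u])].

(* Main.v *)
(* Write [a k = p k (s q k + 1 - q k)] and [f x = sum_k a k x^k]. By the
   branching property, for an event [L] of the first [n] generations,
     E[1_L H_l(Z_(n+m)) s^M_(n+m) t^Z_(n+m)] = E[1_L s^M_n c_m(Z_n)],
   where [c_m(k)] is the coefficient of X^l in [V_m ^ k], with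
   [V_m = f^m (t (1 + X))] modulo X^(l+1). As p(0) = 0, Z_n >= r^n almost
   surely, and it suffices that [c_m(k) / c_m(r^n)] tends to 0 uniformly in
   [k > r^n]: the conditioned measure then concentrates on [Z_n = r^n].
   Coefficients being nonnegative, [c_m(k) <= d^-l V_m(d)^k] for every d > 0,
   whereas [c_m(r^n)] is at least a constant times [b_m ^ (r^n)] for a sequence
   satisfying [b_(m+1) = alpha b_m ^ r]; since [f y <= alpha y^r (1 + y / alpha)]
   for [0 <= y <= 1], [V_m(d)] satisfies nearly the same recursion, and taking d
   small makes it close enough to [b_m].

   The limit measure is the law of the r-ary tree marked with the digits of a
   uniform point of [0, 1]. Each marked r-ary tree of height n receives the same
   mass from it as from E[1_. B], and both have total mass 1. *)

Require Import Defs.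
From HB Require Import structures.
From mathcomp Require Import all_boot all_order all_algebra.
From mathcomp Require Import finmap.
From mathcomp Require Import all_classical all_reals all_analysis.
From mathcomp Require Import measurable_realfun.
From mathcomp Require Import ring lra zify.

Import Order.TTheory GRing.Theory Num.Theory.
Import numFieldNormedType.Exports.

Local Open Scope classical_set_scope.
Local Open Scope ring_scope.

Set Implicit Arguments.
Unset Strict Implicit.
Unset Printing Implicit Defensive.

(** * Generating functions modulo a power of X *)

(** For a natural number z, [H_l(z) t^z] is the coefficient of [X^l] in [(t (1 + X))^z], so the
    factorial weight goes through the branching property by composition of polynomials, with no
    derivative of an iterated function. The moment of order l forces the truncation: for t = 1,
    [t (1 + d)] exceeds 1 for every d > 0, where f may diverge, so the first composition makes sense
    only coefficient by coefficient. From then on the constant coefficient is below 1 and evaluation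
    at a small d > 0 is available. All of this rests on [kappa = f(1) < 1]: since s < 1 and marks
    occur with positive probability, the weights [a k] lose mass, and the constant coefficients tend
    to 0 even for t = 1, where they would otherwise stay equal to 1. Their smallness is what makes
    the powers [k > r^n] negligible. The coefficient of [X^l] may vanish in the first iterates,
    hence estimates that start at a later index. *)

Lemma nneseries_cauchy (R : realType) (g : nat -> nat -> \bar R) :
  (forall i j, (0 <= g i j)%E) ->
  (\sum_(0 <= z <oo) \sum_(i < z.+1) g i (z - i)%N =
   \sum_(0 <= i <oo) \sum_(0 <= j <oo) g i j)%E.
Proof.
move=> g0.
have g0' z i : (0 <= if (i <= z)%N then g i (z - i)%N else 0)%E by case: ifP.
transitivity (\sum_(0 <= z <oo) \sum_(0 <= i <oo)
    if (i <= z)%N then g i (z - i)%N else 0)%E.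
  apply: eq_eseriesr => z _; rewrite (nneseries_split 0 z.+1)//.
  rewrite add0n [X in (_ + X)%E]eseries0 ?adde0; last first.
    by move=> i zi _; rewrite leqNgt zi.
  rewrite big_mkord; apply: eq_bigr => i _.
  by rewrite -ltnS ltn_ord.
rewrite nneseries_interchange//; apply: eq_eseriesr => i _.
rewrite (nneseries_split 0 i)// add0n big_nat big1 ?add0e; last first.
  by move=> z /= zi; rewrite leqNgt zi.
rewrite -nneseries_addn//; apply: eq_eseriesr => j _.
by rewrite leq_addl addnK.
Qed.

(* The law of the next generation, weighted by [s] to the number of new marks,
   when the current generation has [k] nodes of weighted offspring law [a]. *)
Fixpoint convpow (R : realType) (a : nat -> R) (k z : nat) : R :=
  if k is k'.+1 then \sum_(i < z.+1) a i * convpow a k' (z - i)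
  else (z == 0%N)%:R.

(* The composition of the generating function [sum_k a k X^k] with [V], modulo
   [X^(l+1)]; [fine] is harmless as long as [gensummable a l V]. *)
Definition gensum (R : realType) (a : nat -> R) (l : nat) (V : {poly R}) :
    {poly R} :=
  \poly_(j < l.+1) fine (\sum_(0 <= z <oo) (a z * (V ^+ z)`_j)%:E)%E.

Definition coef_ge0 (R : realType) (V : {poly R}) := forall j, 0 <= V`_j.

Definition gensummable (R : realType) (a : nat -> R) (l : nat) (V : {poly R}) :=
  forall j, (j <= l)%N -> (\sum_(0 <= z <oo) (a z * (V ^+ z)`_j)%:E < +oo)%E.

Lemma coef_ge0M (R : realType) (U V : {poly R}) :
  coef_ge0 U -> coef_ge0 V -> coef_ge0 (U * V).
Proof.
by move=> U0 V0 j; rewrite coefM; apply: sumr_ge0 => i _; apply: mulr_ge0.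
Qed.

Lemma coef_ge0X (R : realType) (V : {poly R}) n :
  coef_ge0 V -> coef_ge0 (V ^+ n).
Proof.
move=> V0; elim: n => [|n IH]; last by rewrite exprS; apply: coef_ge0M.
by move=> j; rewrite expr0 coef1 ler0n.
Qed.

Section GenSum.
Context {R : realType} {a : nat -> R} {l : nat}.
Hypothesis a_ge0 : forall k, 0 <= a k.

Lemma convpow_ge0 k z : 0 <= convpow a k z.
Proof.
elim: k z => [|k IH] z /=; first by rewrite ler0n.
by apply: sumr_ge0 => i _; apply: mulr_ge0.
Qed.

Lemma gensum_ge0 V : coef_ge0 V -> coef_ge0 (gensum a l V).
Proof.
move=> V0 j; rewrite coef_poly; case: ifP => // _; apply: fine_ge0.
apply: nneseries_ge0 => z _ _; rewrite lee_fin mulr_ge0//.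
exact: coef_ge0X.
Qed.

Lemma coef_gensum V j : coef_ge0 V -> gensummable a l V -> (j <= l)%N ->
  ((gensum a l V)`_j)%:E = (\sum_(0 <= z <oo) (a z * (V ^+ z)`_j)%:E)%E.
Proof.
move=> V0 sV jl; rewrite coef_poly ltnS jl fineK// ge0_fin_numE ?sV//.
by apply: nneseries_ge0 => z _ _; rewrite lee_fin mulr_ge0 ?coef_ge0X.
Qed.

(* The generating function of a sum of [k] independent offspring numbers,
   evaluated at a truncated power series [V] instead of at a number. *)
Lemma convpow_series V k j : coef_ge0 V -> gensummable a l V -> (j <= l)%N ->
  (\sum_(0 <= z <oo) (convpow a k z * (V ^+ z)`_j)%:E)%E
  = ((gensum a l V ^+ k)`_j)%:E.
Proof.
move=> V0 sV; elim: k j => [|k IH] j jl.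
  rewrite expr0 (nneseries_split 0 1); last first.
    by move=> z _; rewrite lee_fin mulr_ge0 ?convpow_ge0 ?coef_ge0X.
  rewrite add0n big_nat1 /= mul1r expr0 eseries0 ?adde0//.
  by move=> [|z]//= _ _; rewrite mul0r.
pose g i z : \bar R := (a i * convpow a k z * (V ^+ (i + z))`_j)%:E.
have g0 i z : (0 <= g i z)%E.
  by rewrite lee_fin !mulr_ge0 ?convpow_ge0 ?coef_ge0X.
transitivity (\sum_(0 <= z <oo) \sum_(i < z.+1) g i (z - i)%N)%E.
  apply: eq_eseriesr => z _ /=; rewrite /g mulr_suml -sumEFin.
  by apply: eq_bigr => i _; rewrite subnKC// -ltnS.
rewrite nneseries_cauchy//.
transitivity (\sum_(0 <= i <oo) \sum_(e < j.+1)
   (((gensum a l V ^+ k)`_(j - e))%:E * (a i * (V ^+ i)`_e)%:E))%E.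
  apply: eq_eseriesr => i _.
  transitivity (\sum_(0 <= z <oo) \sum_(e < j.+1) (a i * (V ^+ i)`_e)%:E *
     (convpow a k z * (V ^+ z)`_(j - e))%:E)%E.
    apply: eq_eseriesr => z _; rewrite /g exprD coefM mulr_sumr -sumEFin.
    by apply: eq_bigr => e _; rewrite -EFinM; congr (_%:E); ring.
  rewrite nneseries_sum; last first.
    move=> e z _; rewrite -EFinM lee_fin !mulr_ge0 ?convpow_ge0//;
    exact: coef_ge0X.
  apply: eq_bigr => e _; rewrite nneseriesZl; last first.
    by move=> z _; rewrite lee_fin mulr_ge0 ?convpow_ge0 ?coef_ge0X.
  by rewrite (IH _ (leq_trans (leq_subr _ _) jl)) muleC.
rewrite nneseries_sum; last first.
  move=> e z _; rewrite -EFinM lee_fin !mulr_ge0//; try exact: coef_ge0X.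
  exact/coef_ge0X/gensum_ge0.
rewrite exprS coefM -sumEFin; apply: eq_bigr => e _.
rewrite nneseriesZl; last first.
  by move=> z _; rewrite lee_fin mulr_ge0 ?coef_ge0X.
have el : (e <= l)%N by rewrite (leq_trans _ jl)// -ltnS.
by rewrite -(coef_gensum V0 sV el) -EFinM mulrC.
Qed.

End GenSum.

Lemma coef0_exp (R : nzRingType) (U : {poly R}) n : (U ^+ n)`_0 = U`_0 ^+ n.
Proof.
by elim: n => [|n IH]; rewrite ?expr0 ?coef1// !exprS coef0M IH.
Qed.

Lemma le_coef_horner (R : realType) (U : {poly R}) n d :
  coef_ge0 U -> 0 <= d -> \sum_(j < n) U`_j * d ^+ j <= U.[d].
Proof.
move=> U0 d0; rewrite (@horner_coef_wide _ (maxn n (size U))) ?leq_maxr//.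
rewrite -!(big_mkord xpredT (fun j => U`_j * d ^+ j)).
rewrite (@big_cat_nat _ _ _ n _ (maxn n (size U)))//= ?leq_maxl// lerDl.
by apply: sumr_ge0 => j _; rewrite mulr_ge0 ?exprn_ge0.
Qed.

Lemma coef_le_horner (R : realType) (U : {poly R}) j d :
  coef_ge0 U -> 0 <= d -> U`_j * d ^+ j <= U.[d].
Proof.
move=> U0 d0; apply: le_trans (le_coef_horner j.+1 U0 d0).
by rewrite big_ord_recr lerDr sumr_ge0// => i _; rewrite mulr_ge0 ?exprn_ge0.
Qed.

(** Cauchy's estimate; for nonnegative coefficients one positive point replaces the circle. *)
Lemma coef_le_Vhorner (R : realType) (U : {poly R}) j d :
  coef_ge0 U -> 0 < d -> U`_j <= d ^- j * U.[d].
Proof.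
move=> U0 d0; rewrite ler_pdivlMl ?exprn_gt0// mulrC.
exact/coef_le_horner/ltW.
Qed.

Lemma horner_ge0 (R : realType) (U : {poly R}) d :
  coef_ge0 U -> 0 <= d -> 0 <= U.[d].
Proof.
move=> U0 d0; rewrite (le_trans _ (le_coef_horner 0 U0 d0))//.
by rewrite big_ord0.
Qed.

(** The one-sided punctured neighbourhood lets a single [d > 0] satisfy several strict inequalities
    that hold at 0. *)
Lemma horner_right_lt (R : realType) (U : {poly R}) c :
  U.[0] < c -> \forall d \near 0^'+, U.[d] < c.
Proof.
move=> Uc; apply: (@cvg_within _ (nbhs (0 : R))).
exact: (cvgr_lt U.[0] (@continuous_horner _ U 0)).
Qed.

(** * Evaluating one composition at a nonnegative point *)

Section GenSumBounds.
Context {R : realType} {a : nat -> R} {l r : nat} {kappa : R}.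
Hypothesis a_ge0 : forall k, 0 <= a k.
Hypothesis a_sum : (\sum_(0 <= k <oo) (a k)%:E = kappa%:E)%E.
Hypothesis kappa_lt1 : kappa < 1.
Hypothesis a_min : forall k, (k < r)%N -> a k = 0.
Hypothesis r_gt0 : (0 < r)%N.
Implicit Type V : {poly R}.

Let series_ge0 V d : coef_ge0 V -> 0 <= d ->
  forall k, (0 <= (a k * V.[d] ^+ k)%:E)%E.
Proof. by move=> V0 d0 k; rewrite lee_fin mulr_ge0 ?exprn_ge0 ?horner_ge0. Qed.

Lemma weight_le k : a k <= kappa.
Proof.
rewrite -lee_fin -a_sum (@nneseriesD1 _ _ k)//; last by move=> *; rewrite lee_fin.
by rewrite leeDl// nneseries_ge0// => *; rewrite lee_fin.
Qed.

(** By Cauchy's estimate [d ^- j] bounds the j-th coefficient of every power of [V], so the total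
    weight [kappa] gives finiteness. *)
Lemma gensummable_horner V d : coef_ge0 V -> 0 < d -> V.[d] <= 1 ->
  gensummable a l V.
Proof.
move=> V0 d0 V1 j _.
apply: (@le_lt_trans _ _ (\sum_(0 <= z <oo) ((d ^- j)%:E * (a z)%:E))%E).
  apply: lee_nneseries => [z _ _|z _]; first by rewrite lee_fin mulr_ge0 ?coef_ge0X.
  rewrite -EFinM lee_fin mulrC ler_wpM2r//.
  apply: le_trans (coef_le_Vhorner j (coef_ge0X z V0) d0) _.
  have d1 : 0 <= d by exact: ltW.
  by rewrite ler_piMr ?invr_ge0 ?exprn_ge0// horner_exp exprn_ile1 ?horner_ge0.
by rewrite nneseriesZl ?a_sum -?EFinM ?ltry// => k _; rewrite lee_fin.
Qed.

(** Only an inequality, because the truncation drops the nonnegative coefficients of [V ^+ z] beyond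
    [l]. *)
Lemma horner_gensum_le V d : coef_ge0 V -> gensummable a l V -> 0 <= d ->
  (((gensum a l V).[d])%:E <= \sum_(0 <= z <oo) (a z * V.[d] ^+ z)%:E)%E.
Proof.
move=> V0 sV d0; rewrite (@horner_coef_wide _ l.+1) ?size_poly// -sumEFin.
have -> : (\sum_(j < l.+1) ((gensum a l V)`_j * d ^+ j)%:E =
    \sum_(j < l.+1) \sum_(0 <= z <oo) (d ^+ j)%:E * (a z * (V ^+ z)`_j)%:E)%E.
  apply: eq_bigr => j _; rewrite nneseriesZl; last first.
    by move=> z _; rewrite lee_fin mulr_ge0 ?coef_ge0X.
  by rewrite -(coef_gensum a_ge0 V0 sV (ltn_ord j : (j <= l)%N)) -EFinM mulrC.
rewrite -nneseries_sum; last first.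
  by move=> j z _; rewrite -EFinM lee_fin !mulr_ge0 ?exprn_ge0//; exact: coef_ge0X.
apply: lee_nneseries => z _.
  move=> _; apply: sume_ge0 => j _; rewrite -EFinM lee_fin !mulr_ge0 ?exprn_ge0//.
  exact: coef_ge0X.
under eq_bigr do rewrite -EFinM mulrCA.
rewrite sumEFin lee_fin -mulr_sumr ler_wpM2l// -horner_exp.
under eq_bigr do rewrite mulrC.
exact/le_coef_horner/d0/coef_ge0X.
Qed.

(** There is no weight at 0 since [r > 0], and [y ^+ z <= y] for [z >= 1] and [0 <= y <= 1]. *)
Lemma horner_gensum_le_kappa V d : coef_ge0 V -> gensummable a l V -> 0 <= d ->
  V.[d] <= 1 -> (gensum a l V).[d] <= kappa * V.[d].
Proof.
move=> V0 sV d0 V1; rewrite -lee_fin (le_trans (horner_gensum_le V0 sV d0))//.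
rewrite EFinM muleC -a_sum -nneseriesZl; last by move=> *; rewrite lee_fin.
apply: lee_nneseries => [z _ _|z _]; first exact: series_ge0.
rewrite -EFinM lee_fin mulrC; have y0 := horner_ge0 V0 d0.
have [z0|z0] := posnP z; first by rewrite a_min ?z0// !mulr0.
by rewrite ler_wpM2r// -(prednK z0) exprS ler_piMr// exprn_ile1.
Qed.

(** The term of index [r] is kept exactly; the others have exponent at least [r.+1] and total weight
    at most [kappa < 1]. *)
Lemma horner_gensum_le_min V d : coef_ge0 V -> gensummable a l V -> 0 <= d ->
  V.[d] <= 1 -> (gensum a l V).[d] <= a r * V.[d] ^+ r + V.[d] ^+ r.+1.
Proof.
move=> V0 sV d0 V1; rewrite -lee_fin (le_trans (horner_gensum_le V0 sV d0))//.
have y0 := horner_ge0 V0 d0.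
rewrite (@nneseriesD1 _ _ r)//; last by move=> *; exact: series_ge0.
rewrite EFinD leeD2l//.
apply: (@le_trans _ _
    (\sum_(0 <= k <oo | k != r) ((V.[d] ^+ r.+1)%:E * (a k)%:E))%E).
  apply: lee_nneseries => [z _ _|z zr]; first exact: series_ge0.
  rewrite -EFinM lee_fin mulrC; case: ltngtP zr => // zr _.
    by rewrite a_min// !mulr0.
  by rewrite ler_wpM2r// ler_wiXn2l.
rewrite nneseriesZl; last by move=> *; rewrite lee_fin.
rewrite -[leRHS]mule1 lee_pmul//.
- by rewrite lee_fin exprn_ge0.
- by apply: nneseries_ge0 => *; rewrite lee_fin.
- apply: (@le_trans _ _ (\sum_(0 <= k <oo) (a k)%:E)%E); last first.
    by rewrite a_sum lee_fin ltW.
  by apply: subset_lee_nneseries => // *; rewrite lee_fin.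
Qed.

Lemma coef_gensum_ge V k j : coef_ge0 V -> gensummable a l V -> (j <= l)%N ->
  a k * (V ^+ k)`_j <= (gensum a l V)`_j.
Proof.
move=> V0 sV jl; rewrite -lee_fin coef_gensum// (@nneseriesD1 _ _ k)//; last first.
  by move=> z _; rewrite lee_fin mulr_ge0 ?coef_ge0X.
rewrite leeDl// nneseries_ge0// => z _ _.
by rewrite lee_fin mulr_ge0 ?coef_ge0X.
Qed.

End GenSumBounds.

(** * Iterated composition and ratios of coefficients *)

Section GenSumIter.
Context {R : realType} {a : nat -> R} {l r k1 : nat} {kappa : R}.
Hypothesis a_ge0 : forall k, 0 <= a k.
Hypothesis a_sum : (\sum_(0 <= k <oo) (a k)%:E = kappa%:E)%E.
Hypothesis kappa_lt1 : kappa < 1.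
Hypothesis a_min : forall k, (k < r)%N -> a k = 0.
Hypothesis r_gt0 : (0 < r)%N.
Hypothesis ar_gt0 : 0 < a r.
Hypothesis k1_gt1 : (1 < k1)%N.
Hypothesis ak1_gt0 : 0 < a k1.
Variable V0 : {poly R}.
Hypothesis V0_ge0 : coef_ge0 V0.
Hypothesis V0_sum : gensummable a l V0.
Hypothesis V00 : 0 < V0`_0 <= 1.
Hypothesis V01 : 0 < V0`_1.

Let V m := iter m (gensum a l) V0.

Lemma iter_gensum_ge0 m : coef_ge0 (V m).
Proof. by elim: m => [//|m IH]; apply: gensum_ge0. Qed.

Let kappa_ge0 : 0 <= kappa.
Proof. exact: le_trans (a_ge0 r) (weight_le a_ge0 a_sum r). Qed.

Let gensum0_le U : coef_ge0 U -> gensummable a l U -> U`_0 <= 1 ->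
  (gensum a l U)`_0 <= kappa * U`_0.
Proof.
move=> U0 sU; rewrite -!horner_coef0 => U1.
exact: (horner_gensum_le_kappa a_ge0 a_sum a_min r_gt0 U0 sU (lexx 0) U1).
Qed.

(** The first iterate is below 1 at 0, hence at some [d > 0]. Values at [d] do not increase
    afterwards, so this one [d] serves all later iterates; index 0 is the hypothesis [V0_sum]. *)
Lemma iter_gensum_summable m : gensummable a l (V m).
Proof.
case: m => [//|m].
have V1 : (V 1).[0] < 1.
  rewrite horner_coef0; apply: le_lt_trans (gensum0_le _ _ _) _ => //.
    by case/andP: V00.
  rewrite (le_lt_trans _ kappa_lt1)// ler_piMr//; by case/andP: V00.
near (0 : R)^'+ => d.
have d0 : 0 < d by [].
suff Vd : (V m.+1).[d] <= 1.
  by apply: (gensummable_horner a_ge0 a_sum _ d0) => //; exact: iter_gensum_ge0.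
elim: m => [|m IH].
  by apply: ltW; near: d; exact: horner_right_lt.
rewrite (le_trans (horner_gensum_le_kappa a_ge0 a_sum a_min r_gt0
  (iter_gensum_ge0 m.+1) _ (ltW d0) IH))//.
  by apply: (gensummable_horner a_ge0 a_sum _ d0) => //; exact: iter_gensum_ge0.
rewrite mulr_ile1//; last exact: ltW.
by apply: horner_ge0 (ltW d0); exact: iter_gensum_ge0.
Unshelve. all: by end_near. Qed.

Lemma iter_gensum0_gt0 m : 0 < (V m)`_0.
Proof.
elim: m => [|m IH]; first by case/andP: V00.
have := coef_gensum_ge a_ge0 r (iter_gensum_ge0 m) (@iter_gensum_summable m) (leq0n l).
by apply: lt_le_trans; rewrite mulr_gt0// coef0_exp exprn_gt0.
Qed.

Lemma iter_gensum0_le m : (V m)`_0 <= kappa ^+ m.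
Proof.
elim: m => [|m IH]; first by rewrite expr0; case/andP: V00.
have m1 : kappa ^+ m <= 1 by rewrite exprn_ile1// ltW.
have := gensum0_le (iter_gensum_ge0 m) (@iter_gensum_summable m) (le_trans IH m1).
by move=> /le_trans; apply; rewrite exprS ler_wpM2l.
Qed.

(* Since [k1 > 1], each iteration makes one more coefficient positive. *)
Lemma iter_gensum_gt0 m j : (j <= m.+1)%N -> (j <= l)%N -> 0 < (V m)`_j.
Proof.
elim: m j => [|m IH] [|j] jm jl; rewrite ?iter_gensum0_gt0//.
  by case: j jm jl => [|].
have := coef_gensum_ge a_ge0 k1 (iter_gensum_ge0 m) (@iter_gensum_summable m) jl.
apply: lt_le_trans; rewrite mulr_gt0//.
have V_ge0 := iter_gensum_ge0 m.
have jm1 : (j <= m.+1)%N by [].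
have mul_gt0 (U W : {poly R}) i1 i2 : coef_ge0 U -> coef_ge0 W -> 0 < U`_i1 ->
    0 < W`_i2 -> 0 < (U * W)`_(i1 + i2).
  move=> U0 W0 U1 W2; have i1P : (i1 < (i1 + i2).+1)%N by rewrite ltnS leq_addr.
  rewrite coefM (bigD1 (Ordinal i1P))//= addKn ltr_wpDr ?mulr_gt0//.
  by apply: sumr_ge0 => i _; rewrite mulr_ge0.
(* Two factors of [V m ^+ k1] are singled out, one giving degree 1 and the other degree [j]; the
   rest give their constant coefficients. *)
have -> : k1 = (k1 - 2).+2 by move: k1_gt1; lia.
rewrite exprS -(add1n j); apply: (mul_gt0) => //; first exact: coef_ge0X.
  by apply: IH => //; exact: leq_ltn_trans jl.
have := mul_gt0 (V m) (V m ^+ (k1 - 2)) j 0%N; rewrite addn0 -exprS; apply=> //.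
- exact: coef_ge0X.
- by apply: IH => //; exact: ltnW.
by rewrite coef0_exp exprn_gt0// iter_gensum0_gt0.
Qed.

Let alpha_lt1 : a r < 1.
Proof. exact: le_lt_trans (weight_le a_ge0 a_sum r) kappa_lt1. Qed.

(* With [u m] the constant coefficient of [V m] and [y m] its value at a small
   [d > 0], both essentially satisfy [x (m+1) = alpha * (x m) ^ r]; the point
   is that [y ^ k0.+1 / u ^ k0] tends to [0], which holds when [d] is chosen
   such that the two sequences start close enough to each other. *)
Lemma iter_gensum_ratio k0 : (0 < k0)%N -> (0 < l)%N ->
  exists m0 D beta, [/\ 0 <= D, 0 <= beta < 1 & forall n,
    0 < (V (m0 + n) ^+ k0)`_l /\
    forall k, (k0 < k)%N ->
      (V (m0 + n) ^+ k)`_l <= D * beta ^+ n * (V (m0 + n) ^+ k0)`_l].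
Proof.
move=> k0_gt0 l_gt0; set al := a r.
(* One iteration raises the quotient [y ^+ k0.+1 / b ^+ k0] to the power [r] and multiplies it by at
   most [G.[y]]. The surplus exponent leaves a factor [al], so [G.[0] = al < 1]. *)
pose G : {poly R} := al%:P * (1 + al^-1 *: 'X) ^+ k0.+1.
have GE x : G.[x] = al * (1 + x / al) ^+ k0.+1.
  by rewrite /G hornerM horner_exp hornerC hornerD !hornerE [x / _]mulrC.
have kappa_cvg : kappa ^+ m @[m --> \oo] --> (0 : R).
  by apply: cvg_expr; rewrite ger0_norm.
(* [l <= m0] makes the l-th coefficient positive; the other two conditions hold eventually, as
   constant coefficients are at most [kappa ^+ m]. *)
have [m0 [m0l Vm0_lt1 GVm0]] : exists m0, [/\ (l <= m0)%N,
    (V m0)`_0 < 1 & G.[(V m0)`_0] < 1].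
  near \oo => m; exists m; split; first by near: m; exact: nbhs_infty_ge.
    rewrite (le_lt_trans (iter_gensum0_le m))//; near: m.
    exact: (cvgr_lt 0 kappa_cvg).
  have GK : G.[kappa ^+ m] < 1.
    near: m.
    have : G.[kappa ^+ m] @[m --> \oo] --> G.[0].
      by apply: (@cvg_comp _ _ _ _ (horner G) _ _ _ kappa_cvg); exact: continuous_horner.
    move=> /cvgr_lt; apply; rewrite GE mul0r addr0 expr1n mulr1; exact: alpha_lt1.
  apply: le_lt_trans GK; rewrite !GE ler_pM2l// lerXn2r ?nnegrE//.
  - by rewrite addr_ge0// divr_ge0 ?ltW// iter_gensum0_gt0.
  - by rewrite addr_ge0// divr_ge0 ?exprn_ge0// ltW.
  - by rewrite lerD2l ler_pM2r ?invr_gt0// iter_gensum0_le.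
set u := (V m0)`_0; have u_gt0 : 0 < u by exact: iter_gensum0_gt0.
have Gu0 : 0 < G.[u].
  by rewrite GE mulr_gt0// exprn_gt0// addr_gt0// divr_gt0.
have [beta [beta_gt0 beta_lt1 Gub]] :
    exists beta, [/\ 0 < beta, beta < 1 & G.[u] < beta].
  by exists ((G.[u] + 1) / 2); split; move: GVm0; rewrite -/u; lra.
(* At 0 the three bounds are strict, the last because [u < 1]; it starts the induction of [yb]. *)
have [d [d0 Vd1 Gd Vd]] : exists d, [/\ 0 < d, (V m0).[d] <= 1,
    G.[(V m0).[d]] <= beta & (V m0).[d] ^+ k0.+1 <= u ^+ k0].
  near (0 : R)^'+ => d; exists d; split => //; apply: ltW.
  - near: d; apply: horner_right_lt.
    by rewrite horner_coef0.
  - rewrite -horner_comp; near: d; apply: horner_right_lt.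
    by rewrite horner_comp horner_coef0.
  - rewrite -horner_exp; near: d; apply: horner_right_lt.
    by rewrite horner_exp horner_coef0 -/u exprS gtr_pMl ?exprn_gt0.
pose y n := (V (m0 + n)).[d].
(* Keeping only the term of index [r] gives a lower bound [b] for the constant coefficients. *)
pose b n := iter n (fun x => al * x ^+ r) u.
(* The bound [w * b n] on the l-th coefficient persists: the l-th coefficient of a power is at least
   that of one factor times the constant coefficients of the others. *)
have [w w_gt0 wE] : exists2 w, 0 < w & (V m0)`_l = w * u.
  exists ((V m0)`_l / u); last by rewrite divfK// gt_eqF.
  by rewrite divr_gt0// iter_gensum_gt0// ltnW.
have b_gt0 n : 0 < b n by elim: n => //= n IH; rewrite mulr_gt0 ?exprn_gt0.
have al_ge0 : 0 <= al by exact: ltW.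
have b_ge0 n : 0 <= b n by exact: ltW.
have beta_ge0 : 0 <= beta by exact: ltW.
have w_ge0 : 0 <= w by exact: ltW.
have y_ge0 n : 0 <= y n.
  by apply: horner_ge0; [exact: iter_gensum_ge0|exact: ltW].
have y_le n : y n <= (V m0).[d].
  elim: n => [|n IH]; first by rewrite /y addn0.
  have yn1 : y n <= 1 by exact: le_trans Vd1.
  have := horner_gensum_le_kappa a_ge0 a_sum a_min r_gt0 (iter_gensum_ge0 (m0 + n))
    (@iter_gensum_summable (m0 + n)) (ltW d0) yn1.
  rewrite /y addnS => /le_trans; apply; rewrite (le_trans _ IH)//.
  rewrite -[leRHS]mul1r; apply: (ler_wpM2r (y_ge0 n)); exact: ltW.
have y_le1 n : y n <= 1 by exact: le_trans Vd1.
have yS n : y n.+1 <= al * y n ^+ r * (1 + y n / al).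
  have := horner_gensum_le_min a_ge0 a_sum kappa_lt1 a_min (iter_gensum_ge0 (m0 + n))
    (@iter_gensum_summable (m0 + n)) (ltW d0) (y_le1 n).
  rewrite /y addnS => /le_trans; apply; rewrite -/(y n) -/al exprSr.
  by rewrite mulrDr mulr1 [al * _]mulrC -!mulrA [al * _]mulrC divfK// gt_eqF.
have yb n : y n ^+ k0.+1 <= beta ^+ n * b n ^+ k0.
  elim: n => [|n IH]; first by rewrite expr0 mul1r /y addn0.
  have -> : beta ^+ n.+1 * b n.+1 ^+ k0 =
      (al ^+ k0 * (beta ^+ n * (b n ^+ k0) ^+ r)) * beta.
    have -> : b n.+1 = al * b n ^+ r by [].
    rewrite exprMn exprSr [(b n ^+ r) ^+ k0]exprAC; ring.
  have : y n.+1 ^+ k0.+1 <= (al * y n ^+ r * (1 + y n / al)) ^+ k0.+1.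
    by rewrite lerXn2r ?nnegrE ?(le_trans _ (yS n)).
  move=> /le_trans; apply.
  have -> : (al * y n ^+ r * (1 + y n / al)) ^+ k0.+1 =
      (al ^+ k0 * (y n ^+ k0.+1) ^+ r) * G.[y n].
    by rewrite GE !exprMn [(y n ^+ r) ^+ k0.+1]exprAC [al ^+ k0.+1]exprSr; ring.
  apply: ler_pM.
  - by rewrite mulr_ge0 ?exprn_ge0// ltW.
  - by rewrite GE mulr_ge0 ?exprn_ge0 ?addr_ge0 ?divr_ge0.
  - rewrite ler_wpM2l ?exprn_ge0//.
    apply: (@le_trans _ _ ((beta ^+ n * b n ^+ k0) ^+ r)).
      by rewrite lerXn2r ?nnegrE ?exprn_ge0 ?mulr_ge0 ?exprn_ge0.
    rewrite exprMn ler_wpM2r ?exprn_ge0//.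
    have bn1 : beta ^+ n <= 1 by rewrite exprn_ile1// ltW.
    by rewrite -(prednK r_gt0) exprS ler_piMr ?exprn_ge0// exprn_ile1 ?exprn_ge0.
  - apply: le_trans Gd; rewrite !GE ler_pM2l// lerXn2r ?nnegrE//.
    + by rewrite addr_ge0// divr_ge0.
    + by rewrite addr_ge0// divr_ge0 ?(le_trans _ (y_le n)).
    + by rewrite lerD2l ler_pM2r ?invr_gt0.
have ub n : b n <= (V (m0 + n))`_0.
  elim: n => [|n IH]; first by rewrite addn0.
  have := coef_gensum_ge a_ge0 r (iter_gensum_ge0 (m0 + n))
    (@iter_gensum_summable (m0 + n)) (leq0n l).
  rewrite addnS /=; apply: le_trans; rewrite ler_pM2l//.
  by rewrite coef0_exp lerXn2r ?nnegrE ?iter_gensum_ge0.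
have coefX_ge n k : (0 < k)%N ->
    (V (m0 + n))`_0 ^+ k.-1 * (V (m0 + n))`_l <= (V (m0 + n) ^+ k)`_l.
  move=> k_gt0; rewrite -[in leRHS](prednK k_gt0) exprSr coefM big_ord_recl /=.
  rewrite subn0 coef0_exp lerDl.
  apply: sumr_ge0 => i _; rewrite mulr_ge0 ?iter_gensum_ge0//.
  exact/coef_ge0X/iter_gensum_ge0.
have wb n : w * b n <= (V (m0 + n))`_l.
  elim: n => [|n IH]; first by rewrite addn0 wE.
  have := coef_gensum_ge a_ge0 r (iter_gensum_ge0 (m0 + n))
    (@iter_gensum_summable (m0 + n)) (leqnn l).
  rewrite addnS /=; apply: le_trans; rewrite mulrCA ler_pM2l//.
  apply: le_trans (coefX_ge _ _ r_gt0).
  rewrite -[in leLHS](prednK r_gt0) exprSr mulrCA ler_pM ?exprn_ge0 ?mulr_ge0//.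
  by rewrite lerXn2r ?nnegrE ?iter_gensum_ge0.
have low n : w * b n ^+ k0 <= (V (m0 + n) ^+ k0)`_l.
  apply: le_trans (coefX_ge _ _ k0_gt0).
  rewrite -[in leLHS](prednK k0_gt0) exprSr mulrCA ler_pM ?exprn_ge0 ?mulr_ge0//.
  by rewrite lerXn2r ?nnegrE ?iter_gensum_ge0.
(* [d ^- l] comes from Cauchy's estimate, and [w] from the lower bound [low]. *)
exists m0, (d ^- l / w), beta; split.
- by rewrite divr_ge0// invr_ge0 exprn_ge0// ltW.
- by rewrite beta_ge0.
move=> n; split; first by rewrite (lt_le_trans _ (low n))// mulr_gt0 ?exprn_gt0.
move=> k k0k.
apply: le_trans (coef_le_Vhorner l (coef_ge0X k (iter_gensum_ge0 (m0 + n))) d0) _.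
have dl_ge0 : 0 <= d ^- l by rewrite invr_ge0 exprn_ge0// ltW.
rewrite -!mulrA horner_exp -/(y n); apply: (ler_wpM2l dl_ge0).
(* As [y n <= 1], the exponent [k0.+1] is the worst one, which makes the bound uniform in [k]. *)
apply: (@le_trans _ _ (y n ^+ k0.+1)); first by rewrite ler_wiXn2l.
apply: le_trans (yb n) _; rewrite mulrCA ler_wpM2l ?exprn_ge0//.
by rewrite ler_pdivlMl.
Unshelve. all: by end_near. Qed.

End GenSumIter.

(** Offspring numbers above [z] cannot contribute, so the law may be cut at [N]; finite
    distributivity then applies to the power of a polynomial. *)
Lemma convpow_coef (R : realType) (a : nat -> R) N k z : (z <= N)%N ->
  ((\poly_(j < N.+1) a j) ^+ k)`_z = convpow a k z.
Proof.
elim: k z => [|k IH] z zN; first by rewrite expr0 coef1.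
rewrite exprS coefM; apply: eq_bigr => i _; rewrite coef_poly.
have iz : (i <= z)%N by rewrite -ltnS.
by rewrite ltnS (leq_trans iz)// IH// (leq_trans (leq_subr _ _)).
Qed.

Section Convpow.
Context {R : realType} {a : nat -> R} {r : nat}.
Hypothesis a_min : forall k, (k < r)%N -> a k = 0.

Lemma convpow_eq0 k z : (z < r * k)%N -> convpow a k z = 0.
Proof.
elim: k z => [|k IH] z; first by rewrite muln0.
rewrite mulnS => zr /=; apply: big1 => i _.
have [ir|ri] := ltnP i r; first by rewrite a_min// mul0r.
by rewrite IH ?mulr0//; have := ltn_ord i; lia.
Qed.

(** The total [r * k] is reached only with exactly [r] children at each of the [k] nodes, so a
    single term of each convolution survives. *)
Lemma convpow_min k : convpow a k (r * k) = a r ^+ k.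
Proof.
elim: k => [|k IH]; first by rewrite muln0.
have rP : (r < (r + r * k).+1)%N by rewrite ltnS leq_addr.
rewrite mulnS /= (bigD1 (Ordinal rP))//= addKn IH -exprS big1 ?addr0// => i.
rewrite -val_eqE /= => ir.
have [ilr|] := ltnP i r; first by rewrite a_min// mul0r.
by rewrite leq_eqVlt eq_sym (negbTE ir)/= => ri; rewrite convpow_eq0 ?mulr0//; have := ltn_ord i; lia.
Qed.

End Convpow.

(** * Binomial moments as coefficients *)

Lemma bin_le_exp n k : ('C(n, k) <= n ^ k)%N.
Proof.
apply: (@leq_trans (n ^_ k)); first by rewrite -bin_ffact leq_pmulr// fact_gt0.
elim: k n => [|k IH] n //; rewrite ffactnS expnS leq_mul//.
apply: leq_trans (IH _) _; case: k {IH} => // k.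
by rewrite leq_exp2r// leq_pred.
Qed.

Lemma Hpoly_bin (R : realType) l n : Hpoly l n%:R = 'C(n, l)%:R :> R.
Proof.
rewrite /Hpoly; have l0 : (l`!)%:R != 0 :> R by rewrite pnatr_eq0 -lt0n fact_gt0.
apply: (mulfI l0); rewrite mulrA mulfV// mul1r -natrM mulnC bin_ffact.
elim: l {l0} => [|l IH]; first by rewrite big_ord0 ffactn0.
rewrite big_ord_recr /= IH ffactnSr natrM; have [ln|nl] := leqP l n.
  by rewrite natrB.
by rewrite ffact_small// !mul0r.
Qed.

(** The scaling [x -> t x] expanded around [x = 1]: its powers carry binomial coefficients. *)
Definition dilation (R : realType) (t : R) : {poly R} := t%:P * (1 + 'X).

Lemma coef_dilationX (R : realType) (t : R) n j :
  (dilation t ^+ n)`_j = 'C(n, j)%:R * t ^+ n.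
Proof.
rewrite exprMn -polyC_exp coefCM mulrC; congr (_ * _).
rewrite addrC exprD1n coef_sum.
have [jn|nj] := leqP j n; last first.
  rewrite bin_small// big1// => i _; rewrite coefMn coefXn.
  by rewrite gtn_eqF ?mul0rn// (leq_trans _ nj).
have jn1 : (j < n.+1)%N by [].
rewrite (bigD1 (Ordinal jn1))//= coefMn coefXn eqxx big1 ?addr0// => i.
by rewrite -val_eqE /= coefMn coefXn eq_sym => /negbTE ->; rewrite mul0rn.
Qed.

Lemma dilation_ge0 (R : realType) (t : R) : 0 <= t -> coef_ge0 (dilation t).
Proof.
by move=> t0 j; rewrite -[dilation t]expr1 coef_dilationX mulr_ge0.
Qed.

(** The domination ['C(z, j) <= z ^ j <= z ^ l] needs [z >= 1] in its second half; at [z = 0] the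
    term vanishes because [a 0 = 0]. *)
Lemma gensummable_dilation (R : realType) (a p : nat -> R) l t :
  0 <= t <= 1 -> a 0%N = 0 -> (forall k, 0 <= a k <= p k) ->
  has_moment p l -> gensummable a l (dilation t).
Proof.
move=> /andP[t0 t1] a0 ap pl j jl; apply: le_lt_trans pl.
apply: lee_nneseries => [z _ _|z _]; rewrite lee_fin coef_dilationX.
  by case/andP: (ap z) => az _; rewrite !mulr_ge0// exprn_ge0.
case: z => [|z]; first by rewrite a0 mul0r mulr_ge0// (le_trans _ (andP (ap 0%N)).2) ?a0.
rewrite mulrC; case/andP: (ap z.+1) => az azp; rewrite ler_pM//.
  by rewrite mulr_ge0 ?exprn_ge0.
rewrite -[leRHS]mulr1 ler_pM ?exprn_ge0//; last by rewrite exprn_ile1.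
rewrite -natrX ler_nat (leq_trans (bin_le_exp _ _))//.
by rewrite leq_pexp2l.
Qed.

(** * Truncations of marked trees *)

Lemma markedTree_eq (t t' : markedTree) :
  (forall u, nodes t u <-> nodes t' u) -> mark t =1 mark t' -> t = t'.
Proof.
case: t => n m tn mn; case: t' => n' m' tn' mn' /= nn mm.
have En : n = n' by apply/seteqP; split => u /nn.
have Em : m = m' by apply/funext.
subst n' m'; by rewrite (Prop_irrelevance tn tn') (Prop_irrelevance mn mn').
Qed.

Lemma rstar_eqP n t t' : rstar n t = rstar n t' <->
  (forall u, (size u <= n)%N -> (nodes t u <-> nodes t' u)) /\
  (forall u, (size u < n)%N -> mark t u = mark t' u).
Proof.
split=> [E|[En Em]].
  split=> u un.
    have := congr1 (fun x => nodes x u) E; rewrite /= => E'.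
    by split=> tu; [have : nodes t u /\ (size u <= n)%N by []; rewrite E' => -[]|
      have : nodes t' u /\ (size u <= n)%N by []; rewrite -E' => -[]].
  by have := congr1 (fun x => mark x u) E; rewrite /= un !andbT.
apply: markedTree_eq => u /=; first by split=> -[tu un]; split=> //; apply/En.
by case: ltnP => un; rewrite ?andbF// !andbT Em.
Qed.

Lemma rstar_leq m n t t' : (m <= n)%N ->
  rstar n t = rstar n t' -> rstar m t = rstar m t'.
Proof.
move=> mn /rstar_eqP[En Em]; apply/rstar_eqP; split=> u um.
  by apply: En; exact: leq_trans mn.
by apply: Em; exact: leq_trans mn.
Qed.

Lemma FnP n (L : set markedTree) :
  Fn n L <-> forall t t', rstar n t = rstar n t' -> L t -> L t'.
Proof.
split=> [[B _ <-] t t' E [_ Bt]|Lr]; first by split=> //=; rewrite -E.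
exists [set t | exists2 t', t = rstar n t' & L t'] => //.
apply/seteqP; split=> t; first by move=> [_ [t' E Lt']]; exact: (Lr t').
by move=> Lt; split=> //; exists t.
Qed.

Lemma Fn_mono m n L : (m <= n)%N -> Fn m L -> Fn n L.
Proof.
move=> mn /FnP LP; apply/FnP => t t' /(rstar_leq mn) E; exact: LP.
Qed.

Lemma Fn_measurable n L : Fn n L -> measurable L.
Proof. by move=> FL; apply: sub_sigma_algebra; exists n. Qed.

(** F_n-measurability in a form that asks for no sigma-field on the codomain. *)
Definition rdep (T : Type) n (f : markedTree -> T) :=
  forall t t', rstar n t = rstar n t' -> f t = f t'.

Lemma rdep_Fn T n (f : markedTree -> T) B : rdep n f -> Fn n (f @^-1` B).
Proof. by move=> fr; apply/FnP => t t' E; rewrite /preimage/= (fr _ _ E). Qed.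

Lemma rdep_leq T m n (f : markedTree -> T) : (m <= n)%N -> rdep m f -> rdep n f.
Proof. by move=> mn fr t t' /(rstar_leq mn); exact: fr. Qed.

Lemma rdep_measurable d (T : measurableType d) n (f : markedTree -> T) :
  rdep n f -> measurable_fun setT f.
Proof.
by move=> fr _ B _; rewrite setTI; apply: (@Fn_measurable n); exact: rdep_Fn.
Qed.

Lemma rdep_indic (R : realType) n L : Fn n L -> rdep n (\1_L : markedTree -> R).
Proof.
move=> /FnP LP t t' E; rewrite !indicE; congr (_ (_ : bool))%:R.
by apply/idP/idP; rewrite !inE; [exact: LP|apply: LP].
Qed.

Lemma level_rstar m n t t' : (m <= n)%N -> rstar n t = rstar n t' ->
  level t m = level t' m.
Proof.
move=> mn /rstar_eqP[En _]; apply/seteqP; split=> u [tu um]; split=> //;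
by apply/En => //; rewrite um.
Qed.

Lemma below_rstar m n t t' : (m <= n.+1)%N -> rstar n t = rstar n t' ->
  below t m = below t' m.
Proof.
move=> mn /rstar_eqP[En _]; apply/seteqP; split=> u [tu um]; split=> //;
by apply/En => //; rewrite -ltnS (leq_trans um).
Qed.

Lemma rdep_Zn m n : (m <= n)%N -> rdep n (Zn m).
Proof. by move=> mn t t' E; rewrite /Zn (level_rstar mn E). Qed.

Lemma rdep_Mn m n : (m <= n)%N -> rdep n (Mn m).
Proof.
move=> mn t t' E; rewrite /Mn (below_rstar (leqW mn) E).
apply: eq_big_seq => u; rewrite in_fset_set; last exact: finite_below.
rewrite inE => -[_ um]; move/rstar_eqP: E => [_ ->] //.
exact: leq_trans mn.
Qed.

Lemma kids_eq t u k : nodes t u ->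
  (forall i, (0 < i)%N -> (nodes t (rcons u i) <-> (i <= k)%N)) -> kids t u = k.
Proof.
move=> tu kP; have kk i : (0 < i)%N -> (i <= k)%N = (i <= kids t u)%N.
  by move=> i0; apply/idP/idP; rewrite -kP// -kidsP.
apply/eqP; rewrite eqn_leq; apply/andP; split.
  by case: (kids t u) kk => // k' kk; rewrite kk.
by case: k kk {kP} => // k' kk; rewrite -kk.
Qed.

Lemma kids_rstar n t t' u : rstar n.+1 t = rstar n.+1 t' -> nodes t u ->
  (size u <= n)%N -> kids t u = kids t' u.
Proof.
move=> /rstar_eqP[En _] tu un; symmetry; apply: kids_eq => [|i i0].
  by apply/En => //; exact: leqW.
by rewrite -kidsP//; split => [/En|/En]; apply; rewrite size_rcons.
Qed.

Lemma mem_level t n u : (u \in fset_set (level t n)) = (u \in level t n).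
Proof. by rewrite in_fset_set//; exact: finite_level. Qed.

Lemma mem_below t n u : (u \in fset_set (below t n)) = (u \in below t n).
Proof. by rewrite in_fset_set//; exact: finite_below. Qed.

Lemma perm_below t n : perm_eq (fset_set (below t n.+1))
  (fset_set (below t n) ++ fset_set (level t n)).
Proof.
apply: uniq_perm; first exact: fset_uniq.
  rewrite cat_uniq !fset_uniq /= andbT -all_predC; apply/allP => u /=.
  by rewrite mem_level inE => -[_ un]; rewrite mem_below; apply/negP; rewrite inE => -[_]; rewrite un ltnn.
move=> u; rewrite mem_cat !mem_below mem_level; apply/idP/orP.
  rewrite inE => -[tu]; rewrite ltnS leq_eqVlt => /orP[/eqP un|un]; first by right; rewrite inE.
  by left; rewrite inE.
by case; rewrite !inE => -[tu un]; split=> //; [exact: leqW|rewrite un].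
Qed.

Lemma Mn_recr n t :
  Mn n.+1 t = (Mn n t + \sum_(u <- fset_set (level t n)) mark t u)%N.
Proof. by rewrite /Mn (perm_big _ (perm_below t n)) big_cat. Qed.

Lemma perm_level t n : perm_eq (fset_set (level t n.+1))
  [seq rcons u i | u <- fset_set (level t n), i <- iota 1 (kids t u)].
Proof.
apply: uniq_perm; first exact: fset_uniq.
  apply: allpairs_uniq_dep => [|u _|]; rewrite ?fset_uniq ?iota_uniq//.
  by move=> [u i] [v j] _ _ /= /rcons_inj[-> ->].
case: (nodes_tree t) => tpos _ tpar _.
move=> v; rewrite mem_level; apply/idP/allpairsPdep.
  rewrite inE; case/lastP: v => [[]//|u i] [tui]; rewrite size_rcons => -[un].
  have tu := tpar _ _ tui; have i0 : (0 < i)%N.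
    by have := tpos _ tui; rewrite all_rcons => /andP[].
  exists u, i; split=> //; first by rewrite mem_level inE.
  by rewrite mem_iota i0 add1n ltnS; apply/(kidsP tu).
move=> [u [i [+ + ->]]]; rewrite mem_level inE mem_iota => -[tu un].
move=> /andP[i0]; rewrite add1n ltnS => ik; rewrite inE; split.
  by apply/(kidsP tu).
by rewrite size_rcons un.
Qed.

Lemma Zn_recr n t :
  Zn n.+1 t = (\sum_(u <- fset_set (level t n)) kids t u)%N.
Proof.
rewrite /Zn (perm_size (perm_level t n)) size_allpairs_dep sumnE big_map.
by apply: eq_bigr => u _; rewrite size_iota.
Qed.

Lemma rstarS_eqP n t t' : rstar n.+1 t = rstar n.+1 t' <->
  rstar n t = rstar n t' /\
  (forall u, level t' n u -> kids t u = kids t' u /\ mark t u = mark t' u).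
Proof.
split=> [E|[E km]].
  split; first exact: rstar_leq E.
  move=> u; rewrite -(level_rstar (leqnSn n) E) => -[tu un].
  rewrite (kids_rstar E)// ?un//; split=> //.
  by case/rstar_eqP: E => _ ->//; rewrite un.
have /rstar_eqP[En Em] := E.
apply/rstar_eqP; split=> u; last first.
  rewrite ltnS leq_eqVlt => /orP[/eqP un|]; last exact: Em.
  case: (pselect (nodes t' u)) => tu; first by have [] := km u (conj tu un).
  have unN : (size u <= n)%N by rewrite un.
  transitivity false; last symmetry; apply/negP => /mark_nodes// tu'.
  by apply: tu; apply/En.
rewrite leq_eqVlt => /orP[/eqP|]; last exact: En.
case/lastP: u => [//|u i]; rewrite size_rcons => -[un].
case: (nodes_tree t) => tpos _ tpar _.
case: (nodes_tree t') => tpos' _ tpar' _.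
have lu : nodes t u -> level t' n u by move=> tu; split=> //; apply/En => //; rewrite un.
split=> tui.
  have tu := tpar _ _ tui; have [tu' _] := lu tu.
  have i0 : (0 < i)%N by have := tpos _ tui; rewrite all_rcons => /andP[].
  by apply/(kidsP tu') => //; have [<- _] := km u (lu tu); apply/(kidsP tu).
have tu' := tpar' _ _ tui; have tu : nodes t u by apply/En => //; rewrite un.
have i0 : (0 < i)%N by have := tpos' _ tui; rewrite all_rcons => /andP[].
by apply/(kidsP tu) => //; have [-> _] := km u (lu tu); apply/(kidsP tu').
Qed.

Definition cyl n t : set markedTree := [set tau | rstar n tau = rstar n t].

Lemma cyl_Fn n t : Fn n (cyl n t).
Proof. by apply/FnP => u u' E; rewrite /cyl /= E. Qed.

(** An integer code of the truncation, so that the cylinders form a countable partition. Nodes at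
    level [n] survive truncation but their marks do not, hence [n.+1] for the nodes and [n] for the
    marks. *)
Definition rcode n (t : markedTree) : nat :=
  choice.pickle (fset_set (below t n.+1) : {fset (seq nat)},
    fset_set [set u | mark t u && (size u < n)%N] : {fset (seq nat)}).

Lemma rcodeP n t t' : rcode n t = rcode n t' <-> rstar n t = rstar n t'.
Proof.
have finm (t1 : markedTree) : finite_set [set u | mark t1 u && (size u < n)%N].
  apply: sub_finite_set (finite_below t1 n) => u /andP[mu un].
  by split=> //; exact: mark_nodes.
split=> [/(pcan_inj choice.pickleK)[Eb Em]|E].
  have {}Eb := fset_set_inj (finite_below t n.+1) (finite_below t' n.+1) Eb.
  have {}Em := fset_set_inj (finm t) (finm t') Em.
  apply: markedTree_eq => [u|u] /=.
    have := congr1 (@^~ u) Eb; rewrite /below /= !ltnS => Ebu.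
    by split=> H; [rewrite -Ebu|rewrite Ebu].
  have := congr1 (@^~ u) Em; rewrite /= => Emu.
  by apply/idP/idP => H; [rewrite -Emu|rewrite Emu].
rewrite /rcode (below_rstar _ E)//; congr (choice.pickle (_, fset_set _)).
by move/rstar_eqP: E => [_ Em]; apply/seteqP; split=> u /= /andP[mu un];
  apply/andP; split=> //; rewrite ?Em// -Em.
Qed.

(** Both integrals are sums over the countable partition into cylinders. The functions may look
    beyond generation [n], hence the separate [m]. *)
Lemma integral_cyl_eq (R : realType) (P : {measure set markedTree -> \bar R})
    m n (f g : markedTree -> R) :
  (forall x, 0 <= f x) -> (forall x, 0 <= g x) -> rdep m f -> rdep m g ->
  (forall t, (\int[P]_x (\1_(cyl n t) x * f x)%:E =
              \int[P]_x (\1_(cyl n t) x * g x)%:E)%E) ->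
  (\int[P]_x (f x)%:E = \int[P]_x (g x)%:E)%E.
Proof.
move=> f0 g0 fm gm fg; pose D i : set markedTree := [set t | rcode n t = i].
have DFn i : Fn n (D i).
  by apply/FnP => t t' E Dt; rewrite /D /=; rewrite -Dt; apply/rcodeP.
have split_int (h : markedTree -> R) : (forall x, 0 <= h x) -> rdep m h ->
    (\int[P]_x (h x)%:E =
     \sum_(0 <= i <oo) \int[P]_x (\1_(D i) x * h x)%:E)%E.
  move=> h0 hm; rewrite -integral_nneseries//; last 2 first.
  - move=> i; apply: (@rdep_measurable _ _ (maxn m n)) => x y E.
    rewrite (rdep_indic R (DFn i) (rstar_leq (leq_maxr m n) E)).
    by rewrite (hm _ _ (rstar_leq (leq_maxl m n) E)).
  - by move=> i x _; rewrite lee_fin mulr_ge0.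
  apply: eq_integral => x _; rewrite (@nneseriesD1 _ _ (rcode n x))//; last first.
    by move=> i _; rewrite lee_fin mulr_ge0.
  rewrite indicE mem_set// mul1r eseries0 ?adde0// => i _ ix.
  by rewrite indicE memNset ?mul0r//= => xi; rewrite -xi eqxx in ix.
rewrite !split_int//; apply: eq_eseriesr => i _.
have [[t Dt]|nD] := pselect (exists t, D i t).
  suff -> : D i = cyl n t by exact: fg.
  by apply/seteqP; split=> x; rewrite /D /cyl /= -Dt; move/rcodeP.
have -> : D i = set0 by apply/seteqP; split=> // x Dx; apply: nD; exists x.
by under eq_integral do rewrite indic0 mul0r; under [RHS]eq_integral do rewrite indic0 mul0r.
Qed.

Definition ext_nodes n t (psi : seq nat -> nat * bool) : set (seq nat) :=
  [set u | (nodes t u /\ (size u <= n)%N) \/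
    exists v i, [/\ u = rcons v i, level t n v & (0 < i <= (psi v).1)%N]].

Lemma ext_is_tree n t psi : is_tree (ext_nodes n t psi).
Proof.
have [tpos t0 tpar tkids] := nodes_tree t; split.
- move=> u [[tu _]|[v [i [-> [tv _] /andP[i0 _]]]]]; first exact: tpos.
  by rewrite all_rcons i0 tpos.
- by left.
- move=> u j [[tu]|[v [i [/rcons_inj[-> _] [tv vn] _]]]].
    by rewrite size_rcons => /ltnW un; left; split=> //; exact: tpar tu.
  by left; rewrite vn.
- move=> u [[tu]|[v [i [-> [_ vn] _]]]]; last first.
    exists 0%N => j j0; split; last by rewrite leqNgt j0.
    case=> [[_]|[v' [j' [/rcons_inj[<- _] [_]]]]]; rewrite !size_rcons vn.
      by rewrite ltnNge leqnSn.
    by move=> /esym/eqP; rewrite -[X in X == _]addn0 -addn1 eqn_add2l.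
  rewrite leq_eqVlt => /orP[/eqP un|un].
    exists (psi u).1 => j j0; split=> [[[_]|]|ju].
    + by rewrite size_rcons un ltnn.
    + by move=> [v [i [/rcons_inj[-> ->] _ /andP[]]]].
    + by right; exists u, j; split=> //; rewrite j0.
  have [k kP] := tkids u tu; exists k => j j0; rewrite -kP//; split=> [[[]//|]|tj].
    by move=> [v [i [/rcons_inj[uv _] [_ vn]]]]; move: un; rewrite uv vn ltnn.
  by left; rewrite size_rcons.
Qed.

Lemma ext_mark_nodes n t (psi : seq nat -> nat * bool) u :
  (mark t u && (size u < n)%N) || (`[< level t n u >] && (psi u).2) ->
  ext_nodes n t psi u.
Proof.
case/orP => /andP[]; first by move=> /mark_nodes tu /ltnW un; left.
by move=> /asboolP[tu un] _; left; rewrite un.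
Qed.

(* The truncation of [t] at level [n] continued by one generation, where [psi]
   gives the number of children and the mark of the nodes at level [n]. *)
Definition ext n t psi : markedTree :=
  MarkedTree (ext_is_tree n t psi) (@ext_mark_nodes n t psi).

Lemma rstar_ext n t psi : rstar n (ext n t psi) = rstar n t.
Proof.
apply/rstar_eqP; split=> u un /=.
  split=> [[[]//|[v [i [uE [_ vn] _]]]]|tu]; last by left.
  by move: un; rewrite uE size_rcons vn ltnn.
rewrite un andbT; case: asboolP => [[_ un']|_]; last by rewrite orbF.
by move: un; rewrite un' ltnn.
Qed.

Lemma kids_ext n t psi u : level t n u -> kids (ext n t psi) u = (psi u).1.
Proof.
move=> [tu un]; apply: kids_eq => [|i i0]; first by left; rewrite un.
split=> [[[_]|]|iu]; first by rewrite size_rcons un ltnn.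
  by move=> [v [j [/rcons_inj[-> ->] _ /andP[]]]].
by right; exists u, i; rewrite i0.
Qed.

Lemma mark_ext n t psi u : level t n u -> mark (ext n t psi) u = (psi u).2.
Proof.
by move=> tu; rewrite /= asboolT//; case: tu => _ ->; rewrite ltnn andbF.
Qed.

Lemma cyl_extP n t psi tau : cyl n.+1 (ext n t psi) tau <->
  cyl n t tau /\
  (forall u, level t n u -> kids tau u = (psi u).1 /\ mark tau u = (psi u).2).
Proof.
have El : level (ext n t psi) n = level t n by apply: level_rstar (rstar_ext _ _ _).
split=> [/rstarS_eqP|] [].
  rewrite rstar_ext El => E km; split=> // u tu; have := km u tu.
  by rewrite kids_ext// mark_ext.
move=> E km; apply/rstarS_eqP; rewrite rstar_ext; split=> // u.
by rewrite El => tu; rewrite kids_ext// mark_ext//; exact: km.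
Qed.

(** * One step of the branching process *)

(** Distributivity expands a product of [#|I|] polynomials, whose z-th coefficient collects the
    families with total [z]; marks are summed out. No entry of such a family exceeds [z], hence
    ['I_z.+1]. *)
Lemma sum_ffun_convpow (R : realType) (I : finType) (w : nat -> bool -> R) z :
  \sum_(phi : {ffun I -> 'I_z.+1 * bool})
     ((\sum_i (phi i).1)%N == z)%:R * \prod_i w (phi i).1 (phi i).2 =
  convpow (fun k => w k true + w k false) #|I| z.
Proof.
rewrite -(convpow_coef _ _ (leqnn z)).
have -> : \poly_(j < z.+1) (w j true + w j false) =
    \sum_(x : 'I_z.+1 * bool) w x.1 x.2 *: 'X^(x.1).
  rewrite poly_def -(pair_big xpredT xpredT
    (fun (j : 'I_z.+1) (b : bool) => w j b *: 'X^j)) /=.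
  by apply: eq_bigr => j _; rewrite big_bool scalerDl.
rewrite -prodr_const.
rewrite (bigA_distr_bigA (fun (i : I) (x : 'I_z.+1 * bool) => w x.1 x.2 *: 'X^(x.1))).
rewrite coef_sum; apply: eq_bigr => phi _.
rewrite scaler_prod prodrXr coefZ coefXn.
by rewrite mulrC eq_sym.
Qed.

Section MarkedGW.
Context {R : realType} {p q : nat -> R} {P : probability markedTree R} {s : R}.
Hypothesis p_ge0 : forall k, 0 <= p k.
Hypothesis q01 : is_mark_function q.
Hypothesis P_GW : is_marked_GW p q P.
Hypothesis s_ge0 : 0 <= s.

(* [alpha], as the weighted law of the number of children of a node: a node
   with [k] children carries the weight [s ^ mark]. *)
Definition tilted (p q : nat -> R) s k := alpha p q k s.

Lemma prob_cyl n t : P (cyl n t) =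
  (\prod_(u <- fset_set (below t n)) p0 p q (kids t u) (mark t u))%:E.
Proof.
case: n => [|n]; last exact: P_GW.
(* [P_GW] only speaks of positive heights; at height 0 all trees have the same truncation, the
   unmarked root. *)
have -> : cyl 0 t = setT.
  apply/seteqP; split=> // x _; apply/rstar_eqP; split=> u //.
  case: u => // _; have [_ x0 _ _] := nodes_tree x.
  by have [_ t0 _ _] := nodes_tree t.
have -> : below t 0 = set0 by apply/seteqP; split=> // u [].
by rewrite fset_set0 big_nil probability_setT.
Qed.

Lemma prob_cylS n t : P (cyl n.+1 t) =
  (P (cyl n t) * (\prod_(u <- fset_set (level t n)) p0 p q (kids t u) (mark t u))%:E)%E.
Proof. by rewrite !prob_cyl (perm_big _ (perm_below t n)) big_cat. Qed.

(** The default value is never read, since [ext] consults its argument only at level [n] of [t]. *)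
Let profile n t z (phi : {ffun fset_set (level t n) -> 'I_z.+1 * bool})
    (u : seq nat) : nat * bool :=
  if insub u is Some i then ((phi i).1 : nat, (phi i).2) else (0%N, false).

(** Given the first [n] generations and a next one of size [z], finitely many continuations remain:
    child numbers and marks on level [n]. At a given [x] at most one term is nonzero, the one read
    off from [x]. *)
Lemma cyl_step n t (z : nat) x :
  \1_(cyl n t) x * (s ^+ Mn n.+1 x * (Zn n.+1 x == z)%:R) =
  \sum_(phi : {ffun fset_set (level t n) -> 'I_z.+1 * bool})
    ((\sum_i (phi i).1)%N == z)%:R * s ^+ (Mn n t + \sum_i (phi i).2) *
    \1_(cyl n.+1 (ext n t (profile phi))) x :> R.
Proof.
have [xt|xt] := pselect (cyl n t x); last first.
  rewrite indicE memNset// mul0r big1// => phi _.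
  by rewrite indicE memNset ?mulr0// => /cyl_extP[].
rewrite indicE mem_set// mul1r Zn_recr Mn_recr (level_rstar (leqnn n) xt).
rewrite (rdep_Mn (leqnn n) xt) !big_seq_fsetE /=.
have lev (i : fset_set (level t n)) : level t n (val i).
  by have := valP i; rewrite mem_level inE.
have cylE (phi : {ffun fset_set (level t n) -> 'I_z.+1 * bool}) :
    cyl n.+1 (ext n t (profile phi)) x <->
    forall i, kids x (val i) = (phi i).1 /\ mark x (val i) = (phi i).2.
  split=> [/cyl_extP[_ km] i|km].
    by have := km _ (lev i); rewrite /profile valK.
  apply/cyl_extP; split=> // u ut; rewrite /profile.
  have uI : u \in fset_set (level t n) by rewrite mem_level inE.
  by rewrite insubT; exact: (km (Sub u uI)).
have [Zz|Zz] := eqVneq; last first.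
  rewrite mulr0 big1// => phi _; case: eqP => [phiz|_]; last by rewrite !mul0r.
  rewrite indicE memNset ?mulr0// => /cylE km; move/eqP: Zz; apply.
  by rewrite -phiz; apply: eq_bigr => i _; have [] := km i.
have kz (i : fset_set (level t n)) : (kids x (val i) < z.+1)%N.
  by rewrite ltnS -Zz (bigD1 i)//= leq_addr.
pose phi0 := [ffun i : fset_set (level t n) => (Ordinal (kz i), mark x (val i))].
rewrite (bigD1 phi0)//= [X in _ = _ + X]big1 ?addr0 => [|phi phi_neq].
  rewrite indicE mem_set; last by apply/cylE => i; rewrite ffunE.
  have -> : (\sum_i (phi0 i).1)%N = z.
    by rewrite -[RHS]Zz; apply: eq_bigr => i _; rewrite ffunE.
  rewrite eqxx mul1r !mulr1; congr (s ^+ (_ + _)).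
  by apply: eq_bigr => i _; rewrite ffunE.
rewrite indicE memNset ?mulr0// => /cylE km; move/eqP: phi_neq; apply.
apply/ffunP => i; rewrite ffunE; have [k_i m_i] := km i.
by case: (phi i) k_i m_i => k b /= k_i m_i; congr (_, _) => //; apply/val_inj.
Qed.

Lemma integral_cyl_step n t (z : nat) :
  (\int[P]_x (\1_(cyl n t) x * (s ^+ Mn n.+1 x * (Zn n.+1 x == z)%:R))%:E =
   \int[P]_x (\1_(cyl n t) x * (s ^+ Mn n x * convpow (tilted p q s) (Zn n x) z))%:E)%E.
Proof.
have mcyl m t' : measurable (cyl m t') by exact: Fn_measurable (cyl_Fn m t').
have int_cyl c m t' : 0 <= c ->
    (\int[P]_x (c * \1_(cyl m t') x)%:E = c%:E * P (cyl m t'))%E.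
  move=> c0; under eq_integral do rewrite EFinM.
  rewrite ge0_integralZl_EFin//; last first.
    by apply: (@rdep_measurable _ _ m) => x y E; rewrite (rdep_indic R (cyl_Fn m t') E).
  by rewrite integral_indic// setIT.
have -> : (\int[P]_x (\1_(cyl n t) x * (s ^+ Mn n x * convpow (tilted p q s) (Zn n x) z))%:E)%E
  = ((s ^+ Mn n t * convpow (tilted p q s) (Zn n t) z)%:E * P (cyl n t))%E.
  rewrite -int_cyl; last first.
    rewrite mulr_ge0 ?exprn_ge0// convpow_ge0// => k.
    rewrite mulr_ge0//; case/andP: (q01 k) => q0 q1.
    by rewrite -addrA addr_ge0 ?mulr_ge0 ?subr_ge0.
  apply: eq_integral => x _; rewrite mulrC indicE; case: (boolP (x \in _)) => [|_].
    by rewrite inE => xt; rewrite (rdep_Mn (leqnn n) xt) (rdep_Zn (leqnn n) xt).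
  by rewrite !mulr0.
transitivity (\sum_(phi : {ffun fset_set (level t n) -> 'I_z.+1 * bool})
    \int[P]_x (((\sum_i (phi i).1)%N == z)%:R * s ^+ (Mn n t + \sum_i (phi i).2) *
    \1_(cyl n.+1 (ext n t (profile phi))) x)%:E)%E.
  rewrite -ge0_integral_sum//; last 2 first.
  - move=> phi; apply: (@rdep_measurable _ _ n.+1) => x y E.
    by rewrite (rdep_indic R (cyl_Fn n.+1 _) E).
  - by move=> phi x _; rewrite lee_fin !mulr_ge0 ?exprn_ge0 ?indicE.
  by apply: eq_integral => x _; rewrite cyl_step -sumEFin.
under eq_bigr do rewrite int_cyl ?mulr_ge0 ?exprn_ge0// prob_cylS.
have Eq phi : P (cyl n (ext n t (profile phi))) = P (cyl n t).
  by rewrite /cyl rstar_ext.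
have El phi : level (ext n t (profile phi)) n = level t n.
  by apply: level_rstar (rstar_ext _ _ _).
have [c PE] : exists c, P (cyl n t) = c%:E.
  by exists (fine (P (cyl n t))); rewrite fineK// fin_num_measure.
rewrite PE -EFinM.
have -> : convpow (tilted p q s) (Zn n t) z =
   convpow (fun k => p0 p q k true * s + p0 p q k false) (Zn n t) z.
  congr convpow; apply/funext => k; rewrite /tilted /alpha /p0; ring.
(* With the factor [s] of a new mark put into the weight of its node, summing over the mark yields
   [tilted]. *)
pose w k b := p0 p q k b * s ^+ (b : bool).
have := @sum_ffun_convpow R (fset_set (level t n)) w z.
rewrite -cardfE /w expr1 => Ew.
have -> : (fun k => p0 p q k true * s + p0 p q k false) =
   (fun k => p0 p q k true * s + p0 p q k false * s ^+ false).
  by apply/funext => k; rewrite expr0 mulr1.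
rewrite -Ew mulr_sumr mulr_suml.
rewrite -sumEFin; apply: eq_bigr => phi _.
rewrite Eq El big_seq_fsetE /= PE -!EFinM; congr (_%:E).
have -> : \prod_(i : fset_set (level t n)) p0 p q (kids (ext n t (profile phi)) (val i))
     (mark (ext n t (profile phi)) (val i)) = \prod_i p0 p q (phi i).1 (phi i).2.
  apply: eq_bigr => i _; have li : level t n (val i).
    by have := valP i; rewrite mem_level inE.
  by rewrite kids_ext// mark_ext// /profile valK.
rewrite big_split prodrXr exprD.
move: (s ^+ (\sum_i _)) (\prod_i p0 _ _ _ _) (s ^+ Mn n t) (_ %:R) => S2 w1 S1 d.
by rewrite /=; ring.
Qed.

End MarkedGW.

Section MarkedGWSteps.
Context {R : realType} {p q : nat -> R} {P : probability markedTree R} {s : R}.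
Hypothesis p_ge0 : forall k, 0 <= p k.
Hypothesis q01 : is_mark_function q.
Hypothesis P_GW : is_marked_GW p q P.
Hypothesis s_ge0 : 0 <= s.

Let a := tilted p q s.

Lemma tilted_ge0 k : 0 <= a k.
Proof.
rewrite mulr_ge0//; case/andP: (q01 k) => q0 q1.
by rewrite -addrA addr_ge0 ?mulr_ge0 ?subr_ge0.
Qed.

Lemma rdep_EFin_measurable n (f : markedTree -> R) : rdep n f ->
  measurable_fun setT (fun x => (f x)%:E).
Proof. by move=> fn; apply: (@rdep_measurable _ _ n) => x y E; rewrite (fn _ _ E). Qed.

Lemma rdep_weight T n m (f : nat -> T -> R) (g : markedTree -> T) L :
  Fn n L -> (n <= m)%N -> rdep m g ->
  rdep m (fun x => \1_L x * (s ^+ Mn m x * f (Zn m x) (g x))).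
Proof.
move=> FL nm gm x y E.
rewrite (rdep_indic R FL (rstar_leq nm E)) (rdep_Mn (leqnn m) E).
by rewrite (rdep_Zn (leqnn m) E) (gm _ _ E).
Qed.

Lemma rdep_fun n m (h : nat -> R) L : Fn n L -> (n <= m)%N ->
  rdep m (fun x => \1_L x * (s ^+ Mn m x * h (Zn m x))).
Proof.
by move=> FL nm; apply: (@rdep_weight unit n m (fun z _ => h z) (fun=> tt)).
Qed.

Lemma integral_step_law n L (z : nat) : Fn n L ->
  (\int[P]_x (\1_L x * (s ^+ Mn n.+1 x * (Zn n.+1 x == z)%:R))%:E =
   \int[P]_x (\1_L x * (s ^+ Mn n x * convpow a (Zn n x) z))%:E)%E.
Proof.
move=> FL.
have Fle := rdep_fun (fun k => (k == z)%:R) FL (leqnSn n).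
have Fr := rdep_fun (fun k => convpow a k z) FL (leqnn n).
(* [\1_L] is constant on a cylinder of height [n], hence a scalar there. *)
have cyl_ind (f : markedTree -> R) t x : \1_(cyl n t) x * (\1_L x * f x) =
    \1_L t * (\1_(cyl n t) x * f x).
  rewrite [\1_(cyl n t) x]indicE; case: (boolP (x \in _)) => [|_]; last by rewrite !(mul0r, mulr0).
  by rewrite inE => xt; rewrite !mul1r (rdep_indic R FL xt).
apply: (@integral_cyl_eq _ _ n.+1 n) => //.
- by move=> x; rewrite mulr_ge0// mulr_ge0 ?exprn_ge0.
- move=> x; rewrite mulr_ge0// mulr_ge0 ?exprn_ge0// convpow_ge0//.
  exact: tilted_ge0.
- exact: rdep_leq Fr.
move=> t; under eq_integral do rewrite
  (cyl_ind (fun x => s ^+ Mn n.+1 x * (Zn n.+1 x == z)%:R)) EFinM.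
under [RHS]eq_integral do rewrite
  (cyl_ind (fun x => s ^+ Mn n x * convpow a (Zn n x) z)) EFinM.
rewrite !ge0_integralZl_EFin ?(integral_cyl_step p_ge0 q01 P_GW s_ge0)//.
- move=> x _; rewrite lee_fin mulr_ge0// mulr_ge0 ?exprn_ge0// convpow_ge0//.
  exact: tilted_ge0.
- apply: (@rdep_EFin_measurable n).
  exact: (rdep_fun (fun k => convpow a k z) (cyl_Fn n t) (leqnn n)).
- by move=> x _; rewrite lee_fin mulr_ge0// mulr_ge0 ?exprn_ge0.
- apply: (@rdep_EFin_measurable n.+1).
  exact: (rdep_fun (fun k => (k == z)%:R) (cyl_Fn n t) (leqnSn n)).
Qed.

Lemma integral_step_gensum l n L V j : Fn n L -> coef_ge0 V ->
  gensummable a l V -> (j <= l)%N ->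
  (\int[P]_x (\1_L x * (s ^+ Mn n.+1 x * (V ^+ Zn n.+1 x)`_j))%:E =
   \int[P]_x (\1_L x * (s ^+ Mn n x * (gensum a l V ^+ Zn n x)`_j))%:E)%E.
Proof.
move=> FL V0 sV jl.
have VX0 z : 0 <= (V ^+ z)`_j by exact: coef_ge0X.
transitivity (\sum_(0 <= z <oo) \int[P]_x (((V ^+ z)`_j)%:E *
    (\1_L x * (s ^+ Mn n.+1 x * (Zn n.+1 x == z)%:R))%:E))%E.
  rewrite -integral_nneseries//; last 2 first.
  - move=> z; under eq_fun do rewrite -EFinM.
    apply: (@rdep_EFin_measurable n.+1) => x y E.
    by rewrite (rdep_fun (fun k => (k == z)%:R) FL (leqnSn n) E).
  - by move=> z x _; rewrite -EFinM lee_fin !mulr_ge0// exprn_ge0.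
  apply: eq_integral => x _; rewrite (@nneseriesD1 _ _ (Zn n.+1 x))//; last first.
    by move=> z _; rewrite -EFinM lee_fin !mulr_ge0// exprn_ge0.
  rewrite eqxx mulr1 -EFinM eseries0 ?adde0; first by congr (_%:E); ring.
  by move=> z _; rewrite eq_sym => /negbTE ->; rewrite !mulr0 mule0.
transitivity (\sum_(0 <= z <oo) \int[P]_x (((V ^+ z)`_j)%:E *
    (\1_L x * (s ^+ Mn n x * convpow a (Zn n x) z))%:E))%E.
  apply: eq_eseriesr => z _; rewrite !ge0_integralZl_EFin ?integral_step_law//.
  - by move=> x _; rewrite lee_fin !mulr_ge0 ?exprn_ge0 ?convpow_ge0//; exact: tilted_ge0.
  - apply: (@rdep_EFin_measurable n).
    exact: (rdep_fun (fun k => convpow a k z) FL (leqnn n)).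
  - by move=> x _; rewrite lee_fin !mulr_ge0// exprn_ge0.
  - apply: (@rdep_EFin_measurable n.+1).
    exact: (rdep_fun (fun k => (k == z)%:R) FL (leqnSn n)).
rewrite -integral_nneseries//; last 2 first.
- move=> z; under eq_fun do rewrite -EFinM.
  apply: (@rdep_EFin_measurable n) => x y E.
  by rewrite (rdep_fun (fun k => convpow a k z) FL (leqnn n) E).
- move=> z x _; rewrite -EFinM lee_fin !mulr_ge0 ?exprn_ge0 ?convpow_ge0//.
  exact: tilted_ge0.
apply: eq_integral => x _.
rewrite mulrA EFinM -(convpow_series tilted_ge0 _ V0 sV jl) -nneseriesZl; last first.
  by move=> z _; rewrite lee_fin !mulr_ge0 ?convpow_ge0//; exact: tilted_ge0.
by apply: eq_eseriesr => z _; rewrite -!EFinM; congr (_%:E); ring.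
Qed.

(** The last generation is integrated out first, so [gensum] acts first on [V] itself, whence
    [iterSr]; [L] stays an event of every later generation. *)
Lemma integral_iter_gensum l n m L V : Fn n L ->
  (forall i, coef_ge0 (iter i (gensum a l) V)) ->
  (forall i, gensummable a l (iter i (gensum a l) V)) ->
  (\int[P]_x (\1_L x * (s ^+ Mn (n + m) x * (V ^+ Zn (n + m) x)`_l))%:E =
   \int[P]_x (\1_L x * (s ^+ Mn n x *
     (iter m (gensum a l) V ^+ Zn n x)`_l))%:E)%E.
Proof.
move=> FL; elim: m V => [|m IH] V V0 sV; first by rewrite addn0.
have FL' : Fn (n + m) L by exact: Fn_mono (leq_addr m n) FL.
rewrite addnS (integral_step_gensum FL' (V0 0%N) (sV 0%N) (leqnn l)) IH.
- by rewrite -iterSr.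
- by move=> i; rewrite -iterSr.
- by move=> i; rewrite -iterSr.
Qed.

Section MinimalLevel.
Context {r : nat}.
Hypothesis a_min : forall k, (k < r)%N -> a k = 0.
Hypothesis r_gt0 : (0 < r)%N.

Lemma Zn0 x : Zn 0 x = 1%N.
Proof.
have -> : Zn 0 x = #|` [fset [::] : seq nat]|%fset; last exact: cardfs1.
congr (#|` _|%fset); apply/fsetP => u; rewrite mem_level inE.
apply/idP/eqP => [|->]; first by rewrite inE => -[_ /size0nil].
by rewrite inE; split=> //; have [_ x0 _ _] := nodes_tree x.
Qed.

Lemma Mn0 x : Mn 0 x = 0%N.
Proof.
rewrite /Mn; have -> : below x 0 = set0 by apply/seteqP; split=> // u [].
by rewrite fset_set0 big_nil.
Qed.

Let FT n : Fn n setT. Proof. by apply/FnP. Qed.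

(** The exponent counts the nodes of the r-ary tree before generation [n]. The claims are proved
    together: at most [r ^ n.+1] nodes at generation [n.+1] force at most [r ^ n] at generation [n],
    and smaller sizes there have weight 0 by the second claim. *)
Lemma level_law n :
  (\int[P]_x (s ^+ Mn n x * (Zn n x == r ^ n)%N%:R)%:E =
    (a r ^+ (\sum_(i < n) r ^ i))%:E)%E /\
  forall z, (z < r ^ n)%N -> (\int[P]_x (s ^+ Mn n x * (Zn n x == z)%:R)%:E = 0)%E.
Proof.
elim: n => [|n [IHr IH]].
  under eq_integral do rewrite Zn0 Mn0 expr0 mulr1.
  rewrite big_ord0 integral_cst// mul1e; split; first exact: probability_setT.
  move=> [|//] _; under eq_integral do rewrite Zn0 mulr0.
  exact: integral0.
have recE z : (z <= r ^ n.+1)%N ->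
    (\int[P]_x (s ^+ Mn n.+1 x * (Zn n.+1 x == z)%:R)%:E =
     (convpow a (r ^ n) z * a r ^+ (\sum_(i < n) r ^ i))%:E)%E.
  move=> zr.
  have := integral_step_law z (FT n).
  under eq_integral do rewrite indicT mul1r.
  under [X in _ = X -> _]eq_integral do rewrite indicT mul1r.
  move=> ->.
  transitivity (\int[P]_x (\sum_(k < (r ^ n).+1)
      ((convpow a k z)%:E * (s ^+ Mn n x * (Zn n x == k)%:R)%:E)))%E.
    apply: eq_integral => x _; under eq_bigr do rewrite -EFinM.
    rewrite sumEFin; congr (_%:E).
    have [Zr|rZ] := ltnP (Zn n x) (r ^ n).+1.
      rewrite (bigD1 (Ordinal Zr))//= eqxx mulr1 mulrC big1 ?addr0// => k.
      by rewrite -val_eqE /= eq_sym => /negbTE ->; rewrite !mulr0.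
    rewrite (convpow_eq0 a_min); last first.
      by rewrite (leq_ltn_trans zr)// expnS ltn_pmul2l.
    rewrite mulr0 big1// => k _; rewrite gtn_eqF ?mulr0//.
    by rewrite (leq_trans _ rZ).
  have fm (k : nat) : rdep n (fun x => s ^+ Mn n x * (Zn n x == k)%:R).
    by move=> x y E; rewrite (rdep_Mn (leqnn n) E) (rdep_Zn (leqnn n) E).
  rewrite ge0_integral_sum//; last 2 first.
  - move=> k; under eq_fun do rewrite -EFinM.
    by apply: (@rdep_EFin_measurable n) => x y E; rewrite (fm _ _ _ E).
  - move=> k x _; rewrite -EFinM lee_fin !mulr_ge0 ?exprn_ge0 ?convpow_ge0//.
    exact: tilted_ge0.
  have Eint (k : nat) : (\int[P]_x ((convpow a k z)%:E * (s ^+ Mn n x * (Zn n x == k)%:R)%:E)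
      = (convpow a k z)%:E * \int[P]_x (s ^+ Mn n x * (Zn n x == k)%:R)%:E)%E.
    rewrite ge0_integralZl_EFin//.
    - by move=> x _; rewrite lee_fin !mulr_ge0 ?exprn_ge0.
    - exact: rdep_EFin_measurable (fm k).
    - by rewrite convpow_ge0//; exact: tilted_ge0.
  rewrite big_ord_recr /= Eint IHr big1 ?add0e// => k _.
  by rewrite Eint IH ?mule0.
split=> [|z zr].
  rewrite recE// expnS (convpow_min a_min) -exprD big_ord_recr /=.
  by rewrite addnC.
by rewrite recE 1?ltnW// (convpow_eq0 a_min) ?mul0r// -expnS.
Qed.

End MinimalLevel.
End MarkedGWSteps.

(** * Concentration on minimal levels *)

Section LimitRatio.
Context {R : realType} {p q : nat -> R} {P : probability markedTree R} {s : R}.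
Hypothesis p_ge0 : forall k, 0 <= p k.
Hypothesis q01 : is_mark_function q.
Hypothesis P_GW : is_marked_GW p q P.
Hypothesis s01 : 0 <= s <= 1.
Context {r : nat}.
Let a := tilted p q s.
Hypothesis a_min : forall k, (k < r)%N -> a k = 0.
Hypothesis r_gt0 : (0 < r)%N.

Let s_ge0 : 0 <= s. Proof. by case/andP: s01. Qed.

Lemma integral_level_bounds l n L V eps : Fn n L -> coef_ge0 V -> 0 <= eps ->
  (forall k, (r ^ n < k)%N -> (V ^+ k)`_l <= eps) ->
  (((V ^+ (r ^ n))`_l)%:E *
     (\int[P]_x (\1_L x * (s ^+ Mn n x * (Zn n x == r ^ n)%N%:R))%:E)
   <= \int[P]_x (\1_L x * (s ^+ Mn n x * (V ^+ Zn n x)`_l))%:E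
   <= ((V ^+ (r ^ n))`_l)%:E *
     (\int[P]_x (\1_L x * (s ^+ Mn n x * (Zn n x == r ^ n)%N%:R))%:E) + eps%:E)%E.
Proof.
move=> FL V0 eps0 Veps; set A := (\int[P]_x (\1_L x * (_ * (_ == _)%:R))%:E)%E; set c := (V ^+ (r ^ n))`_l.
have VX0 k : 0 <= (V ^+ k)`_l by exact: coef_ge0X.
have s_le1 k : s ^+ k <= 1 by case/andP: s01 => ? ?; rewrite exprn_ile1.
have mA := rdep_EFin_measurable (rdep_fun (s := s) (fun k => (k == r ^ n)%N%:R) FL (leqnn n)).
have mI := rdep_EFin_measurable (rdep_fun (s := s) (fun k => (V ^+ k)`_l) FL (leqnn n)).
have f0 (h : nat -> R) x : (forall k, 0 <= h k) -> (0 <= (\1_L x * (s ^+ Mn n x * h (Zn n x)))%:E)%E.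
  by move=> h0; rewrite lee_fin !mulr_ge0 ?exprn_ge0.
have cA : (c%:E * A = \int[P]_x (c%:E * (\1_L x * (s ^+ Mn n x * (Zn n x == r ^ n)%N%:R))%:E))%E.
  by rewrite ge0_integralZl_EFin// => [x _|]; [exact: (f0 (fun k => (k == r ^ n)%N%:R))|exact: VX0].
have mcA : measurable_fun setT (fun x => c%:E * (\1_L x * (s ^+ Mn n x * (Zn n x == r ^ n)%N%:R))%:E)%E.
  under eq_fun do rewrite -EFinM.
  apply: (@rdep_EFin_measurable _ n) => x y E; congr (c * _).
  exact: (rdep_fun (s := s) (fun k => (k == r ^ n)%N%:R) FL (leqnn n)).
have fk (k : nat) : rdep n (fun x => s ^+ Mn n x * (Zn n x == k)%:R).
  by move=> x y E; rewrite (rdep_Mn (leqnn n) E) (rdep_Zn (leqnn n) E).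
apply/andP; split.
  rewrite cA; apply: ge0_le_integral => //.
    by move=> x _; rewrite -EFinM lee_fin !mulr_ge0 ?VX0 ?exprn_ge0.
  move=> x _; rewrite -EFinM lee_fin mulrCA ler_wpM2l// mulrCA ler_wpM2l ?exprn_ge0//.
  by case: eqVneq => [->|_]; rewrite ?mulr1// mulr0.
(* [low] has integral 0; adding it makes the upper bound hold at every point, including trees with
   [Zn n x < r ^ n]. *)
pose low x := (\sum_(k < r ^ n) ((V ^+ k)`_l)%:E * (s ^+ Mn n x * (Zn n x == k)%:R)%:E)%E.
have low0 x : (0 <= low x)%E.
  by apply: sume_ge0 => k _; rewrite -EFinM lee_fin !mulr_ge0 ?exprn_ge0.
have mlowk k : measurable_fun setT
    (fun x => ((V ^+ k)`_l)%:E * (s ^+ Mn n x * (Zn n x == k)%:R)%:E)%E.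
  under eq_fun do rewrite -EFinM.
  by apply: (@rdep_EFin_measurable _ n) => x y E; rewrite (fk _ _ _ E).
have mlow : measurable_fun setT low by apply: emeasurable_sum => k; exact: mlowk.
have int_low : (\int[P]_x low x = 0)%E.
  rewrite ge0_integral_sum//; last first.
    by move=> k x _; rewrite -EFinM lee_fin !mulr_ge0 ?exprn_ge0.
  apply: big1 => k _; rewrite ge0_integralZl_EFin//.
  - have [_ ->//] := level_law p_ge0 q01 P_GW s_ge0 a_min r_gt0 n.
    exact: mule0.
  - by move=> x _; rewrite lee_fin !mulr_ge0 ?exprn_ge0.
  - exact: rdep_EFin_measurable (fk k).
have -> : (c%:E * A + eps%:E = \int[P]_x
    (c%:E * (\1_L x * (s ^+ Mn n x * (Zn n x == r ^ n)%N%:R))%:E + eps%:E + low x))%E.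
  rewrite ge0_integralD//; last 2 first.
  - by move=> x _; rewrite adde_ge0// -EFinM lee_fin !mulr_ge0 ?exprn_ge0 ?VX0.
  - exact: emeasurable_funD.
  rewrite int_low adde0 ge0_integralD//.
  - by rewrite cA integral_cst// [X in _ = (_ + _ * X)%E]probability_setT mule1.
  - by move=> x _; rewrite -EFinM lee_fin !mulr_ge0 ?exprn_ge0 ?VX0.
apply: ge0_le_integral => //.
- by move=> x _; exact: (f0 (fun k => (V ^+ k)`_l)).
- by apply: emeasurable_funD => //; exact: emeasurable_funD.
move=> x _; rewrite indicE.
have -> : low x = (\sum_(k < r ^ n) (V ^+ k)`_l * (s ^+ Mn n x * (Zn n x == k)%:R))%:E.
  by rewrite -sumEFin; apply: eq_bigr => k _; rewrite EFinM.
rewrite -EFinM -!EFinD lee_fin.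
have low0' : 0 <= \sum_(k < r ^ n) (V ^+ k)`_l * (s ^+ Mn n x * (Zn n x == k)%:R).
  by apply: sumr_ge0 => k _; rewrite !mulr_ge0 ?exprn_ge0.
case: (boolP (x \in L)) => _; last first.
  by rewrite !mulr0n !mul0r mulr0 add0r addr_ge0.
rewrite !mulr1n !mul1r; move: low0'.
case: (ltngtP (Zn n x) (r ^ n)) => [Zr|rZ|->] low0'; last first.
- by rewrite mulr1n mulr1 mulrC -/c -addrA lerDl addr_ge0.
- rewrite mulr0n !mulr0 add0r -[leLHS]addr0 lerD//.
  by rewrite -[leRHS]mul1r ler_pM ?exprn_ge0//; exact: Veps.
rewrite (bigD1 (Ordinal Zr))//= eqxx mulr1 mulr0n !mulr0 add0r addrCA mulrC lerDl.
by rewrite addr_ge0// sumr_ge0// => k _; rewrite !mulr_ge0 ?exprn_ge0.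
Qed.

End LimitRatio.

Lemma geometric_squeeze (R : realType) (c x : nat -> R) A D beta :
  0 <= beta < 1 -> (forall j, 0 < c j) ->
  (forall j, c j * A <= x j <= c j * A + D * beta ^+ j * c j) ->
  x j / c j @[j --> \oo] --> A.
Proof.
move=> /andP[b0 b1] c0 cx.
apply: (@squeeze_cvgr _ _ _ _ (fun=> A) (fun j => A + D * beta ^+ j)).
- near=> j; have /andP[lo up] := cx j; apply/andP; split.
    by rewrite ler_pdivlMr// mulrC.
  by rewrite ler_pdivrMr// mulrDl [A * _]mulrC.
- exact: cvg_cst.
- rewrite -[X in _ --> X]addr0; apply: cvgD; first exact: cvg_cst.
  rewrite -(mulr0 D); apply: cvgM; first exact: cvg_cst.
  by apply: cvg_expr; rewrite ger0_norm.
Unshelve. all: by end_near. Qed.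

Section Limit.
Context {R : realType} {p q : nat -> R} {P : probability markedTree R} {s : R}.
Context {l r k1 : nat} {kappa t : R}.
Let a := tilted p q s.
Hypothesis p_ge0 : forall k, 0 <= p k.
Hypothesis q01 : is_mark_function q.
Hypothesis P_GW : is_marked_GW p q P.
Hypothesis s01 : 0 <= s <= 1.
Hypothesis a_sum : (\sum_(0 <= k <oo) (a k)%:E = kappa%:E)%E.
Hypothesis kappa_lt1 : kappa < 1.
Hypothesis a_min : forall k, (k < r)%N -> a k = 0.
Hypothesis r_gt0 : (0 < r)%N.
Hypothesis ar_gt0 : 0 < a r.
Hypothesis k1_gt1 : (1 < k1)%N.
Hypothesis ak1_gt0 : 0 < a k1.
Hypothesis t01 : 0 < t <= 1.
Hypothesis sum_t : gensummable a l (dilation t).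
Hypothesis l_gt0 : (0 < l)%N.

(** Divided by [c j], numerator and denominator converge to [A L] and [A setT]; [c j] cancels in the
    quotient, and [level_law] computes [A setT]. *)
Lemma limit_ratio n L : Fn n L ->
  ((\int[P]_x (\1_L x * (s ^+ Mn (n + m) x * (dilation t ^+ Zn (n + m) x)`_l))%:E)
   / (\int[P]_x (s ^+ Mn (n + m) x * (dilation t ^+ Zn (n + m) x)`_l)%:E))%E
  @[m --> \oo] -->
  ((\int[P]_x (\1_L x * (s ^+ Mn n x * (Zn n x == r ^ n)%N%:R))%:E) *
   (a r ^- (\sum_(i < n) r ^ i))%:E)%E.
Proof.
move=> FL; have s_ge0 : 0 <= s by case/andP: s01.
have a_ge0 : forall k, 0 <= a k by exact: tilted_ge0.
have t_gt0 : 0 < t by case/andP: t01.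
have V0_ge0 : coef_ge0 (dilation t) by apply/dilation_ge0/ltW.
have V00 : 0 < (dilation t)`_0 <= 1.
  by rewrite -[dilation t]expr1 coef_dilationX bin0 mul1r expr1.
have V01 : 0 < (dilation t)`_1.
  by rewrite -[dilation t]expr1 coef_dilationX mul1r expr1.
have V_ge0 := @iter_gensum_ge0 _ _ l a_ge0 _ V0_ge0.
have V_sum := iter_gensum_summable a_ge0 a_sum kappa_lt1 a_min r_gt0 V0_ge0 sum_t V00.
have rn_gt0 : (0 < r ^ n)%N by rewrite expn_gt0 r_gt0.
have [m0 [D [beta [D0 beta01 cP]]]] := iter_gensum_ratio a_ge0 a_sum kappa_lt1 a_min
  r_gt0 ar_gt0 k1_gt1 ak1_gt0 V0_ge0 sum_t V00 V01 rn_gt0 l_gt0.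
pose V j := iter (m0 + j) (gensum a l) (dilation t).
pose c j := (V j ^+ (r ^ n))`_l.
have c0 j : 0 < c j by case: (cP j).
pose A L' := (\int[P]_x (\1_L' x * (s ^+ Mn n x * (Zn n x == r ^ n)%N%:R))%:E)%E.
pose I L' m := (\int[P]_x (\1_L' x * (s ^+ Mn (n + m) x * (dilation t ^+ Zn (n + m) x)`_l))%:E)%E.
have bnd L' j : Fn n L' -> ((c j)%:E * A L' <= I L' (j + m0)%N <=
    (c j)%:E * A L' + (D * beta ^+ j * c j)%:E)%E.
  move=> FL'; rewrite /I [(j + m0)%N]addnC.
  rewrite (integral_iter_gensum p_ge0 q01 P_GW s_ge0 _ FL' V_ge0 V_sum).
  apply: (integral_level_bounds p_ge0 q01 P_GW s01 a_min r_gt0 FL') => //.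
  - exact: V_ge0.
  - have b0 : 0 <= beta by case/andP: beta01.
    by rewrite mulr_ge0 ?(ltW (c0 j))// mulr_ge0 ?exprn_ge0.
  by move=> k rk; have [_] := cP j; apply.
have FT : Fn n setT by apply/FnP.
have A_T : A setT = (a r ^+ (\sum_(i < n) r ^ i))%:E.
  have [<- _] := level_law p_ge0 q01 P_GW s_ge0 a_min r_gt0 n.
  by apply: eq_integral => x _; rewrite indicT mul1r.
have A_ge0 L' : (0 <= A L')%E.
  by apply: integral_ge0 => x _; rewrite lee_fin !mulr_ge0 ?exprn_ge0.
have A_fin L' : Fn n L' -> A L' \is a fin_num.
  move=> FL'; rewrite ge0_fin_numE//.
  apply: (@le_lt_trans _ _ (A setT)); last by rewrite A_T ltry.
  apply: ge0_le_integral => //.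
  - by move=> x _; rewrite lee_fin !mulr_ge0 ?exprn_ge0.
  - exact: rdep_EFin_measurable (rdep_fun (s := s) (fun k => (k == r ^ n)%N%:R) FL' (leqnn n)).
  - exact: rdep_EFin_measurable (rdep_fun (s := s) (fun k => (k == r ^ n)%N%:R) FT (leqnn n)).
  - move=> x _; rewrite lee_fin ler_wpM2r ?mulr_ge0 ?exprn_ge0//.
    by rewrite indicT indicE lern1 leq_b1.
have I_fin L' j : Fn n L' -> I L' (j + m0)%N \is a fin_num.
  move=> FL'; have /andP[lo up] := bnd L' j FL'.
  rewrite ge0_fin_numE; last by rewrite (le_trans _ lo)// mule_ge0// lee_fin ltW.
  by rewrite (le_lt_trans up)// -(fineK (A_fin _ FL')) -EFinM -EFinD ltry.
have Icvg L' : Fn n L' -> fine (I L' (j + m0)%N) / c j @[j --> \oo] --> fine (A L').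
  move=> FL'; apply: (@geometric_squeeze _ _ _ _ D beta) => // j.
  have := bnd L' j FL'.
  by rewrite -(fineK (A_fin _ FL')) -(fineK (I_fin _ j FL')) -!EFinM -EFinD !lee_fin.
have AT_gt0 : 0 < fine (A setT) by rewrite A_T exprn_gt0.
have IT_gt0 j : 0 < fine (I setT (j + m0)%N).
  rewrite -lte_fin fineK ?I_fin//; have /andP[lo _] := bnd setT j FT.
  by rewrite (lt_le_trans _ lo)// A_T -EFinM lte_fin mulr_gt0 ?exprn_gt0.
rewrite -(@cvg_shiftn m0).
rewrite -/(A L) -(fineK (A_fin _ FL)) -EFinM.
have -> : a r ^- (\sum_(i < n) r ^ i) = (fine (A setT))^-1 by rewrite A_T.
have AT_neq0 : fine (A setT) != 0 by rewrite gt_eqF.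
have lim : (fine (I L (j + m0)%N) / fine (I setT (j + m0)%N))%:E
    @[j --> \oo] --> (fine (A L) / fine (A setT))%:E.
  apply: cvg_EFin; first exact: nearW.
  apply: cvg_trans (cvgM (Icvg _ FL) (cvgV AT_neq0 (Icvg _ FT))).
  apply: near_eq_cvg; apply: nearW => j /=.
  rewrite /unstable.inv_fun /= invf_div mulrA; congr (_ / _).
  by rewrite divfK// gt_eqF.
apply: cvg_trans lim; apply: near_eq_cvg; apply: nearW => j /=.
have -> : (\int[P]_x (s ^+ Mn (n + (j + m0)) x *
    (dilation t ^+ Zn (n + (j + m0)) x)`_l)%:E)%E = I setT (j + m0)%N.
  by apply: eq_integral => x _; rewrite indicT mul1r.
rewrite -/(I L (j + m0)%N) -(fineK (I_fin _ j FL)) -(fineK (I_fin _ j FT)).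
by rewrite inver gt_eqF.
Qed.

End Limit.

(** * Independent digits of a uniform point *)

Section BernoulliBits.
Context {R : realType} {al : R}.
Hypothesis al01 : 0 <= al <= 1.

Let U : probability (measurableTypeR R) R := uniform_prob (@ltr01 R).

Definition bweight (al : R) (c : bool) : R := if c then al else 1 - al.

Lemma uniform_prob_itv (x y : R) : 0 <= x -> x <= y -> y <= 1 ->
  U `[x, y[%classic = (y - x)%:E.
Proof.
move=> x0 xy y1; rewrite /U /= /uniform_prob integral_uniform_pdf setIidl; last first.
  move=> z; rewrite /= !in_itv /= => /andP[xz zy].
  by rewrite (le_trans x0)//= (le_trans (ltW zy)).
rewrite (eq_integral (fun=> 1%E)); last first.
  move=> z; rewrite inE /= in_itv /= => /andP[xz zy]; rewrite /uniform_pdf.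
  by rewrite (le_trans x0 xz) (le_trans (ltW zy) y1) /= subr0 invr1.
rewrite integral_cst//= mul1e lebesgue_measure_itv /= lte_fin.
move: xy; rewrite le_eqVlt => /orP[/eqP ->|->//].
by rewrite ltxx subrr.
Qed.

(** Half-open intervals suit the strict test in [bit], since both pieces of a cut are again
    half-open; the endpoint 1 is negligible. *)
Lemma uniform_prob01 (A : set R) : measurable A -> U A = U (A `&` `[0, 1[%classic).
Proof.
move=> mA; have m01 : measurable (`[0, 1[%classic : set R) by exact: measurable_itv.
have U01 : U (~` `[0, 1[%classic) = 0%E.
  rewrite [LHS]probability_setC//.
  by rewrite [X in (_ - X)%E](uniform_prob_itv (lexx 0) ler01 (lexx 1)) subr0 subee.
rewrite [LHS](measureDI U mA m01) [X in (X + _)%E](_ : _ = 0%E) ?add0e//.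
apply: (@subset_measure0 _ _ _ U _ (~` `[0, 1[%classic)) => //.
- exact: measurableD.
- exact: measurableC.
Qed.

(** The points of [[0, 1[] with first digits [b 0], ..., [b (n - 1)] fill this interval; [point_itv]
    follows the digits of a point instead. *)
Fixpoint bit_itv (al : R) (b : nat -> bool) n : R * R :=
  if n is n'.+1 then
    let: (x, y) := bit_itv al b n' in
    let m := x + al * (y - x) in if b n' then (x, m) else (m, y)
  else (0, 1).

Fixpoint point_itv (al : R) (w : R) n : R * R :=
  if n is n'.+1 then
    let: (x, y) := point_itv al w n' in
    let m := x + al * (y - x) in if w < m then (x, m) else (m, y)
  else (0, 1).

Definition cut (al : R) (xy : R * R) : R := xy.1 + al * (xy.2 - xy.1).

(* [bit al w] is the expansion of [w] when every interval is cut in the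
   proportion [al : 1 - al]; under the uniform law on [0, 1] the digits are
   independent Bernoulli variables. *)
Definition bit (al : R) (w : R) n : bool := w < cut al (point_itv al w n).

Definition bits_eq (b : nat -> bool) n : set R :=
  [set w | forall i, (i < n)%N -> bit al w i = b i].

Lemma point_itvE w b n : bits_eq b n w -> point_itv al w n = bit_itv al b n.
Proof.
elim: n => [//|n IH] wb /=.
rewrite -IH; last by move=> i i_n; apply: wb; exact: ltnW.
have := wb n (ltnSn n); rewrite /bit /cut; case: (point_itv al w n) => x y /=.
by move=> ->.
Qed.

Lemma bits_eqS b n : bits_eq b n.+1 =
  bits_eq b n `&` [set w | (w < cut al (bit_itv al b n)) = b n].
Proof.
apply/seteqP; split=> w.
  move=> wb; have wbn : bits_eq b n w by move=> i i_n; apply: wb; exact: ltnW.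
  by split=> //=; rewrite -(point_itvE wbn); exact: wb.
move=> [wb /=]; rewrite -(point_itvE wb) => wbn i; rewrite ltnS leq_eqVlt.
by case/orP => [/eqP ->|]; [exact: wbn|exact: wb].
Qed.

Lemma bits_eq_measurable b n : measurable (bits_eq b n).
Proof.
elim: n => [|n IH].
  by rewrite (_ : bits_eq b 0 = setT)//; apply/seteqP; split.
rewrite bits_eqS; apply: measurableI => //; case: (b n).
  rewrite (_ : [set _ | _] = `]-oo, cut al (bit_itv al b n)[%classic).
    exact: measurable_itv.
  by apply/seteqP; split=> w; rewrite /= in_itv.
rewrite (_ : [set _ | _] = `[cut al (bit_itv al b n), +oo[%classic).
  exact: measurable_itv.
by apply/seteqP; split=> w; rewrite /= in_itv /= andbT leNgt; [move=> ->|move/negbTE].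
Qed.

Lemma bit_itv_bounds b n : let: (x, y) := bit_itv al b n in
  [/\ 0 <= x, x <= y, y <= 1 & y - x = \prod_(i < n) bweight al (b i)].
Proof.
elim: n => [|n /=]; first by rewrite /= big_ord0 subr0.
rewrite big_ord_recr /=; case: (bit_itv al b n) => x y [x0 xy y1 <-].
case/andP: al01 => a0 a1; case: (b n); rewrite /bweight; split=> //; try nra.
Qed.

Lemma bits_eq_itv b n : bits_eq b n `&` `[0, 1[%classic =
  `[(bit_itv al b n).1, (bit_itv al b n).2[%classic.
Proof.
elim: n => [|n IH].
  by rewrite (_ : bits_eq b 0 = setT) ?setTI//; apply/seteqP; split.
rewrite bits_eqS setIAC IH; have /= := bit_itv_bounds b n.
rewrite /cut; case: (bit_itv al b n) => x y /= [x0 xy y1 _].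
case/andP: al01 => a0 a1.
have mx : x <= x + al * (y - x) by nra.
have my : x + al * (y - x) <= y by nra.
apply/seteqP; split=> w; case: (b n); rewrite /= !in_itv /=.
- by move=> [/andP[-> _] ->].
- by move=> [/andP[_ ->] /negbT]; rewrite -leNgt => ->.
- by move=> /andP[-> wm]; split=> //=; exact: lt_le_trans my.
- move=> /andP[mw ->]; rewrite (le_trans mx mw); split=> //.
  by apply/negbTE; rewrite -leNgt.
Qed.

Lemma bits_eq_law b n :
  U (bits_eq b n) = (\prod_(i < n) bweight al (b i))%:E.
Proof.
rewrite uniform_prob01; last exact: bits_eq_measurable.
rewrite bits_eq_itv; have := bit_itv_bounds b n.
case: (bit_itv al b n) => x y [x0 xy y1 <-] /=.
exact: uniform_prob_itv.
Qed.

Definition word n (psi : {ffun 'I_n -> bool}) (i : nat) : bool :=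
  if insub i is Some j then psi j else false.

Lemma wordE n (psi : {ffun 'I_n -> bool}) (i : 'I_n) : word psi i = psi i.
Proof. by rewrite /word valK. Qed.

Lemma bits_eq_word n (w : R) : bits_eq (word [ffun i : 'I_n => bit al w i]) n w.
Proof. by move=> i i_n; rewrite /word insubT ffunE. Qed.

Lemma bits_eq_wordP n (w : R) (psi : {ffun 'I_n -> bool}) :
  bits_eq (word psi) n w -> psi = [ffun i : 'I_n => bit al w i].
Proof. by move=> wb; apply/ffunP => i; rewrite ffunE wb// wordE. Qed.

Lemma bits_measurable n (A : set R) :
  (forall w w', (forall i, (i < n)%N -> bit al w i = bit al w' i) -> A w -> A w') ->
  measurable A.
Proof.
move=> AP; rewrite (_ : A = \bigcup_(psi in
    [set psi : {ffun 'I_n -> bool} | exists2 w, bits_eq (word psi) n w & A w])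
    bits_eq (word psi) n).
  apply: fin_bigcup_measurable => [|psi _]; last exact: bits_eq_measurable.
  exact: finite_finset.
apply/seteqP; split=> w.
  move=> Aw; exists [ffun i : 'I_n => bit al w i]; last exact: bits_eq_word.
  by exists w => //; exact: bits_eq_word.
move=> [psi [w' w'b Aw'] wb]; apply: AP Aw' => i i_n.
by rewrite w'b// wb.
Qed.

(** The event is summed over all words of length [n]. The sum factors over positions, and those
    outside [J] contribute [al + (1 - al) = 1]. *)
Lemma bits_law (J : {fset nat}) (b : nat -> bool) :
  U [set w | forall j, j \in J -> bit al w j = b j] =
  (\prod_(j <- J) bweight al (b j))%:E.
Proof.
pose n := (\max_(j <- J) j).+1.
have Jn j : j \in J -> (j < n)%N by move=> jJ; rewrite ltnS leq_bigmax_seq.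
set E := [set _ | _].
have mE : measurable E.
  apply: (@bits_measurable n) => w w' ww' Ew j jJ; rewrite -ww' ?Jn//.
  exact: Ew.
transitivity (\int[U]_w (\1_E w)%:E)%E; first by rewrite integral_indic// setIT.
transitivity (\int[U]_w (\sum_(psi : {ffun 'I_n -> bool})
    ((\prod_(i < n) ((val i \in J) ==> (psi i == b i))%:R)%:E *
     (\1_(bits_eq (word psi) n) w)%:E)))%E.
  apply: eq_integral => w _; rewrite (bigD1 [ffun i : 'I_n => bit al w i])//=.
  rewrite [X in (_ + X)%E]big1 ?adde0 => [|psi psi_neq]; last first.
    rewrite [X in (_ * X%:E)%E]indicE memNset ?mule0//.
    by move=> /bits_eq_wordP wb; rewrite wb eqxx in psi_neq.
  rewrite [X in (_ * X%:E)%E]indicE mem_set ?mule1; last exact: bits_eq_word.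
  congr (_%:E); rewrite indicE; case: (boolP (w \in E)) => [|wE].
    rewrite inE => Ew; rewrite big1// => i _; rewrite ffunE.
    by case: (boolP (val i \in J)) => //= iJ; rewrite Ew ?eqxx.
  have [j [jJ jb]] : exists j, j \in J /\ bit al w j <> b j.
    apply: contrapT => nex; move/negP: wE; apply; rewrite inE => j jJ.
    by apply: contrapT => jb; apply: nex; exists j.
  rewrite (bigD1 (Ordinal (Jn j jJ)))//= jJ ffunE /=.
  by move/eqP/negbTE: jb => ->; rewrite mul0r.
rewrite ge0_integral_sum//; last 2 first.
- move=> psi; apply: emeasurable_funM; first exact: measurable_cst.
  by apply/measurable_EFinP; apply: measurable_indic; exact: bits_eq_measurable.
- by move=> psi w _; rewrite -EFinM lee_fin mulr_ge0// prodr_ge0.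
transitivity (\sum_(psi : {ffun 'I_n -> bool})
    (\prod_(i < n) (((val i \in J) ==> (psi i == b i))%:R * bweight al (psi i)))%:E)%E.
  apply: eq_bigr => psi _; rewrite ge0_integralZl_EFin//; last 2 first.
  - by apply/measurable_EFinP; apply: measurable_indic; exact: bits_eq_measurable.
  - by apply: prodr_ge0.
  rewrite integral_indic//; last exact: bits_eq_measurable.
  rewrite setIT [X in (_ * X)%E]bits_eq_law -EFinM big_split /=.
  by congr (_ * _)%:E; apply: eq_bigr => i _; rewrite wordE.
rewrite sumEFin -(bigA_distr_bigA (fun (i : 'I_n) c =>
  ((val i \in J) ==> (c == b i))%:R * bweight al c)); congr (_%:E).
transitivity (\prod_(i < n) if val i \in J then bweight al (b i) else 1).
  apply: eq_bigr => i _; rewrite big_bool /bweight.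
  by case: (val i \in J); case: (b i) => /=; ring.
rewrite -big_mkcond -(big_mkord (fun i => i \in J) (fun i => bweight al (b i))).
rewrite -big_filter; apply: perm_big; apply: uniq_perm.
- exact/filter_uniq/iota_uniq.
- exact: fset_uniq.
move=> j; rewrite mem_filter mem_index_iota /=.
by case: (boolP (j \in J)) => //= /Jn ->.
Qed.

End BernoulliBits.

(** * Randomly marked regular trees *)

Lemma regular_is_tree r : is_tree (regular_tree r).
Proof.
split=> //.
- by move=> u; apply: sub_all => j /andP[].
- by move=> u j; rewrite /regular_tree /= all_rcons => /andP[].
- move=> u ur; exists r => i i0; rewrite /regular_tree /= all_rcons i0 /=.
  by split=> [/andP[]//|->].
Qed.

Lemma regular_mark_nodes r (m : seq nat -> bool) u :
  m u && all (fun j => (0 < j <= r)%N) u -> regular_tree r u.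
Proof. by case/andP. Qed.

Definition reg_tree r m : markedTree :=
  MarkedTree (regular_is_tree r) (@regular_mark_nodes r m).

Lemma kids_reg_tree r m u : regular_tree r u -> kids (reg_tree r m) u = r.
Proof.
move=> ur; apply: kids_eq => // i i0; rewrite /= /regular_tree /= all_rcons i0 /=.
by split=> [/andP[]//|->].
Qed.

Lemma mark_reg_tree r m u : regular_tree r u -> mark (reg_tree r m) u = m u.
Proof. by rewrite /regular_tree /= => ->; rewrite andbT. Qed.

Lemma rstar_reg_tree n r m m' : rstar n (reg_tree r m) = rstar n (reg_tree r m') <->
  {in fset_set (below (reg_tree r m) n), m =1 m'}.
Proof.
split=> [/rstar_eqP[_ E] u|E].
  rewrite mem_below inE => -[ur un].
  by have := E u un; rewrite !mark_reg_tree.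
apply/rstar_eqP; split=> // u un /=.
case: (boolP (all _ u)) => ur; rewrite ?andbF// !andbT E//.
by rewrite mem_below inE.
Qed.

Lemma Zn_reg_tree n r m : Zn n (reg_tree r m) = (r ^ n)%N.
Proof.
elim: n => [|n IH]; first exact: Zn0.
rewrite Zn_recr (eq_big_seq (fun=> r)) => [|u]; last first.
  by rewrite mem_level inE => -[ur _]; exact: kids_reg_tree.
by rewrite big_const_seq count_predT iter_addn_0 -/(Zn n _) IH expnS.
Qed.

Lemma card_below_reg_tree n r m :
  #|` fset_set (below (reg_tree r m) n)|%fset = (\sum_(i < n) r ^ i)%N.
Proof.
elim: n => [|n IH].
  rewrite big_ord0 (_ : below _ 0 = set0) ?fset_set0//.
  by apply/seteqP; split=> // u [].
rewrite big_ord_recr /= -IH (perm_size (perm_below _ n)) size_cat.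
by rewrite -[X in (_ + X)%N]/(Zn n _) Zn_reg_tree.
Qed.

Section RegularTreeLaw.
Context {R : realType} {al : R} {r : nat}.
Hypothesis al01 : 0 <= al <= 1.

Let U : probability (measurableTypeR R) R := uniform_prob (@ltr01 R).

(** Since [pickle] is injective, distinct nodes are marked by distinct digits. *)
Definition random_reg_tree (al : R) r (w : R) : markedTree :=
  reg_tree r (fun u => bit al w (choice.pickle u)).

Let Phi := random_reg_tree al r.

Lemma random_reg_tree_measurable :
  @measurable_fun _ _ (measurableTypeR R) markedTree setT Phi.
Proof.
apply: (@measurability _ _ _ _ _ Phi Fgen) => // _ [L [n _ FL] <-]; rewrite setTI.
(* The nodes before generation [n] do not depend on the marks, and their codes are below [N]:
   finitely many digits decide [L]. *)
pose N := (\max_(u <- fset_set (below (reg_tree r xpred0) n)) choice.pickle u).+1.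
apply: (@bits_measurable _ al N) => w w' ww'; move/FnP: FL; apply.
apply/rstar_reg_tree => u ubelow; apply: ww'; rewrite ltnS.
exact: (leq_bigmax_seq (F := choice.pickle)).
Qed.

Lemma random_reg_tree_law (J : {fset (seq nat)}) (b : seq nat -> bool) :
  [set` J] `<=` regular_tree r ->
  U (Phi @^-1` [set t | forall u, u \in J -> mark t u = b u]) =
  (\prod_(u <- J) bweight al (b u))%:E.
Proof.
move=> Jr; pose b' j := if choice.unpickle j is Some u then b u else false.
have -> : Phi @^-1` [set t | forall u, u \in J -> mark t u = b u] =
    [set w | forall j, j \in [fset choice.pickle u | u in J]%fset -> bit al w j = b' j].
  apply/seteqP; split=> w wb.
    move=> _ /imfsetP[/= u uJ ->]; rewrite /b' choice.pickleK -wb//.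
    by rewrite mark_reg_tree//; exact: Jr.
  move=> u uJ; rewrite mark_reg_tree; last exact: Jr.
  by rewrite wb ?in_imfset// /b' choice.pickleK.
rewrite [LHS]bits_law// big_imfset/=; last first.
  by move=> u v _ _; apply: (pcan_inj choice.pickleK).
by under eq_bigr do rewrite /b' choice.pickleK.
Qed.

Lemma random_reg_tree_probability : exists Q : probability markedTree R,
  forall A, Q A = U (Phi @^-1` A).
Proof.
pose X : {mfun measurableTypeR R >-> markedTree} :=
  HB.pack Phi (isMeasurableFun.Build _ _ (measurableTypeR R) markedTree Phi
    random_reg_tree_measurable).
by exists (distribution U X).
Qed.

Variable Q : probability markedTree R.
Hypothesis Q_Phi : forall A, Q A = U (Phi @^-1` A).

Lemma random_reg_tree_marked_regular : is_marked_regular_tree r al Q.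
Proof.
have mark1 (u : seq nat) : [set tau | mark tau u] =
    [set t | forall v, v \in [fset u]%fset -> mark t v = true].
  apply/seteqP; split=> t /=; first by move=> tu v; rewrite inE => /eqP ->.
  by apply; rewrite inE.
have Qmark u : regular_tree r u -> Q [set tau | mark tau u] = al%:E.
  move=> ur; rewrite Q_Phi mark1 (@random_reg_tree_law _ (fun=> true)).
    by rewrite big_seq_fset1.
  by move=> v /=; rewrite inE => /eqP ->.
split=> //.
(* Regularity of the whole tree is implied by countably many events, each in some F_n, which provide
   the measurable null set. *)
- pose G n := [set t | forall u, (size u <= n)%N -> (nodes t u <-> regular_tree r u)].
  have mG n : measurable (G n).
    apply: (@Fn_measurable n); apply/FnP => t t' /rstar_eqP[E _] tG u un.
    by rewrite -tG//; split=> /E; apply.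
  exists (~` \bigcap_n G n); split.
  + by apply: measurableC; exact: bigcapT_measurable.
  + rewrite Q_Phi (_ : _ @^-1` _ = set0) ?measure0//.
    by apply/seteqP; split=> // w; apply => n _ u un.
  + apply: subsetC => t tG; apply/seteqP; split=> u; first by move/(tG (size u) I u (leqnn _)).
    by move=> ur; apply/(tG (size u) I u (leqnn _)).
- split=> [u ur|J Jr].
    apply: (@Fn_measurable (size u).+1); apply/FnP => t t' /rstar_eqP[_ E] /=.
    by rewrite E.
  have -> : \bigcap_(i in [set` J]) [set tau | mark tau i] =
      [set t | forall v, v \in J -> mark t v = true].
    by apply/seteqP; split=> t tJ v; exact: tJ.
  rewrite Q_Phi random_reg_tree_law// -prodEFin.
  by apply: eq_big_seq => u uJ; rewrite Qmark//; exact: Jr.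
Qed.

End RegularTreeLaw.

Section TiltedRegular.
Context {R : realType} {p q : nat -> R} {P : probability markedTree R} {s al : R}.
Context {r : nat}.
Let a := tilted p q s.
Hypothesis p_ge0 : forall k, 0 <= p k.
Hypothesis q01 : is_mark_function q.
Hypothesis P_GW : is_marked_GW p q P.
Hypothesis s_ge0 : 0 <= s.
Hypothesis a_min : forall k, (k < r)%N -> a k = 0.
Hypothesis r_gt0 : (0 < r)%N.
Hypothesis al01 : 0 <= al <= 1.
Hypothesis al_weight : forall c : bool, p0 p q r c * s ^+ c = a r * bweight al c.

Let U : probability (measurableTypeR R) R := uniform_prob (@ltr01 R).
Let Phi := random_reg_tree al r.
Variable Q : probability markedTree R.
Hypothesis Q_Phi : forall A, Q A = U (Phi @^-1` A).

Let Itype n := fset_set (below (reg_tree r xpred0) n).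

Definition marking (I : {fset (seq nat)}) (phi : {ffun I -> bool}) (u : seq nat) :=
  if insub u is Some i then phi i else false.

Let marked n (phi : {ffun Itype n -> bool}) := reg_tree r (marking phi).

Lemma cyl_marked_law n (phi : {ffun Itype n -> bool}) :
  Q (cyl n (marked phi)) = (\prod_i bweight al (phi i))%:E.
Proof.
have -> : Q (cyl n (marked phi)) =
    U (Phi @^-1` [set t | forall u, u \in Itype n -> mark t u = marking phi u]).
  rewrite Q_Phi; congr (U _); apply/seteqP; split=> w.
    move/rstar_reg_tree => E u uI; rewrite mark_reg_tree; first exact: E.
    by move: uI; rewrite mem_below inE => -[].
  move=> E; apply/rstar_reg_tree => u uI; rewrite -E//.
  by rewrite mark_reg_tree//; move: uI; rewrite mem_below inE => -[].
rewrite random_reg_tree_law//; last by move=> u /=; rewrite mem_below inE => -[].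
rewrite big_seq_fsetE /=; congr (_%:E); apply: eq_bigr => i _.
by rewrite /marking valK.
Qed.

(** Each node before generation [n] contributes [p0 * s ^ mark], which [al_weight] splits into
    [a r], giving the constant, and [bweight], giving [Q]. *)
Lemma integral_cyl_marked n (phi : {ffun Itype n -> bool}) :
  (\int[P]_x (\1_(cyl n (marked phi)) x *
     (s ^+ Mn n x * (Zn n x == r ^ n)%N%:R))%:E =
   (a r ^+ (\sum_(i < n) r ^ i))%:E * Q (cyl n (marked phi)))%E.
Proof.
have mc := Fn_measurable (cyl_Fn n (marked phi)).
transitivity (\int[P]_x ((s ^+ Mn n (marked phi))%:E * (\1_(cyl n (marked phi)) x)%:E))%E.
  apply: eq_integral => x _; rewrite -EFinM indicE; congr (_%:E).
  case: (boolP (x \in _)) => [|_]; last by rewrite !mulr0n mul0r mulr0.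
  rewrite inE => xt; rewrite (rdep_Mn (leqnn n) xt) (rdep_Zn (leqnn n) xt).
  by rewrite Zn_reg_tree eqxx mul1r mulr1.
rewrite ge0_integralZl_EFin ?exprn_ge0//; last first.
  by apply/measurable_EFinP; exact: measurable_indic.
rewrite integral_indic// setIT [X in (_ * X)%E = _](prob_cyl P_GW) cyl_marked_law -!EFinM.
congr (_%:E); rewrite /Mn -prodrXr -big_split.
rewrite -(card_below_reg_tree n r xpred0) cardfE -prodr_const -big_split /=.
rewrite big_seq_fsetE /=; apply: eq_bigr => i _.
have ir : regular_tree r (fsval i).
  by have := valP i; rewrite /= mem_below inE => -[].
rewrite kids_reg_tree//; move: ir; rewrite /regular_tree /= => ->.
by rewrite andbT /marking valK mulrC al_weight.
Qed.

Lemma marked_neq n (phi psi : {ffun Itype n -> bool}) x :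
  cyl n (marked phi) x -> cyl n (marked psi) x -> phi = psi.
Proof.
rewrite /cyl /= => -> /rstar_reg_tree E; apply/ffunP => i.
by have := E (val i) (valP i); rewrite /marking valK.
Qed.

Let sum_marked n L x : Fn n L ->
  \sum_(phi : {ffun Itype n -> bool}) \1_L (marked phi) * \1_(cyl n (marked phi)) x
  = (if pselect (exists phi : {ffun Itype n -> bool}, cyl n (marked phi) x)
     then \1_L x else 0) :> R.
Proof.
move=> FL; case: pselect => [[phi xphi]|nphi]; last first.
  apply: big1 => phi _; rewrite [X in _ * X]indicE memNset ?mulr0// => xphi.
  by apply: nphi; exists phi.
rewrite (bigD1 phi)//= big1 ?addr0 => [|psi psi_neq].
  by rewrite [X in _ * X]indicE mem_set// mulr1 (rdep_indic R FL xphi).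
rewrite [X in _ * X]indicE memNset ?mulr0// => xpsi.
by rewrite (marked_neq xpsi xphi) eqxx in psi_neq.
Qed.

(** Every value of [Phi] lies in exactly one cylinder of a marked regular tree. *)
Lemma law_marked n L : Fn n L ->
  (Q L = \sum_(phi : {ffun Itype n -> bool})
    (\1_L (marked phi))%:E * Q (cyl n (marked phi)))%E.
Proof.
move=> FL; have mPhi := @random_reg_tree_measurable R al r.
have mPre A : measurable A -> measurable (Phi @^-1` A : set (measurableTypeR R)).
  by move=> mA; rewrite -[X in measurable X]setTI; exact: mPhi.
transitivity (\int[U]_w (\1_(Phi @^-1` L) w)%:E)%E.
  rewrite integral_indic ?setIT ?Q_Phi//; apply: mPre; exact: Fn_measurable FL.
transitivity (\int[U]_w (\sum_(phi : {ffun Itype n -> bool})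
    ((\1_L (marked phi))%:E * (\1_(Phi @^-1` (cyl n (marked phi))) w)%:E)))%E.
  apply: eq_integral => w _; under eq_bigr do rewrite -EFinM.
  rewrite sumEFin; have /= := sum_marked (Phi w) FL.
  case: pselect => [_ ->//|nphi _]; exfalso; apply: nphi.
  exists [ffun i => bit al w (choice.pickle (fsval i))].
  by apply/rstar_reg_tree => u uI; rewrite /marking insubT ffunE.
have mcyl (phi : {ffun Itype n -> bool}) : measurable (Phi @^-1` (cyl n (marked phi)) : set (measurableTypeR R)).
  by apply: mPre; exact: Fn_measurable (cyl_Fn _ _).
rewrite ge0_integral_sum//; last first.
- move=> phi; apply: emeasurable_funM => //.
  by apply/measurable_EFinP; exact: measurable_indic.
apply: eq_bigr => phi _; rewrite ge0_integralZl_EFin//; last first.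
  by apply/measurable_EFinP; exact: measurable_indic.
by rewrite integral_indic// setIT Q_Phi.
Qed.

(** Summing over the disjoint cylinders of marked regular trees gives only [>=]. Used for [L] and
    for its complement, whose two sides have equal totals, it forces equality. *)
Lemma integral_regular n L : Fn n L ->
  (\int[P]_x (\1_L x * (s ^+ Mn n x * (Zn n x == r ^ n)%N%:R))%:E =
   (a r ^+ (\sum_(i < n) r ^ i))%:E * Q L)%E.
Proof.
have c_ge0 : 0 <= a r ^+ (\sum_(i < n) r ^ i) by rewrite exprn_ge0// tilted_ge0.
pose A L' := (\int[P]_x (\1_L' x * (s ^+ Mn n x * (Zn n x == r ^ n)%N%:R))%:E)%E.
have mA L' : Fn n L' -> measurable_fun setT
    (fun x => (\1_L' x * (s ^+ Mn n x * (Zn n x == r ^ n)%N%:R))%:E).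
  move=> FL'; exact: rdep_EFin_measurable
    (rdep_fun (s := s) (fun k => (k == r ^ n)%N%:R) FL' (leqnn n)).
have A_ge L' : Fn n L' -> ((a r ^+ (\sum_(i < n) r ^ i))%:E * Q L' <= A L')%E.
  move=> FL'; rewrite (law_marked FL') ge0_sume_distrr; last first.
    by move=> phi _; rewrite mule_ge0.
  under eq_bigr do rewrite muleCA -integral_cyl_marked.
  rewrite (eq_bigr (fun phi : {ffun Itype n -> bool} =>
     (\int[P]_x ((\1_L' (marked phi))%:E *
     (\1_(cyl n (marked phi)) x * (s ^+ Mn n x * (Zn n x == r ^ n)%N%:R))%:E))%E)); last first.
    move=> phi _; rewrite ge0_integralZl_EFin//.
    - by move=> x _; rewrite lee_fin !mulr_ge0 ?exprn_ge0.
    - by apply: mA; exact: cyl_Fn.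
  have msum (phi : {ffun Itype n -> bool}) : measurable_fun setT (fun x => (\1_L' (marked phi))%:E *
     (\1_(cyl n (marked phi)) x * (s ^+ Mn n x * (Zn n x == r ^ n)%N%:R))%:E)%E.
    by apply: emeasurable_funM => //; apply: mA; exact: cyl_Fn.
  rewrite -ge0_integral_sum//; last first.
    by move=> phi x _; rewrite -EFinM lee_fin !mulr_ge0 ?exprn_ge0.
  apply: ge0_le_integral => //.
  - move=> x _; apply: sume_ge0 => phi _.
    by rewrite -EFinM lee_fin !mulr_ge0 ?exprn_ge0.
  - exact: emeasurable_sum.
  - exact: mA.
  move=> x _; under eq_bigr do rewrite -EFinM mulrA.
  rewrite sumEFin lee_fin -mulr_suml ler_wpM2r ?mulr_ge0 ?exprn_ge0//.
  by rewrite sum_marked//; case: pselect.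
move=> FL; apply/eqP; rewrite eq_le A_ge// andbT.
have FLC : Fn n (~` L).
  by apply/FnP => t t' E nLt Lt'; apply: nLt; move/FnP: FL; apply; [exact: esym E|].
have mL := Fn_measurable FL.
have AD : (A L + A (~` L) = (a r ^+ (\sum_(i < n) r ^ i))%:E)%E.
  have [<- _] := level_law p_ge0 q01 P_GW s_ge0 a_min r_gt0 n.
  rewrite /A -ge0_integralD//.
  - apply: eq_integral => x _; rewrite -EFinD -mulrDl; congr (_%:E).
    rewrite !indicE in_setC; case: (x \in L); rewrite ?addr0 ?add0r mul1r//.
  - by move=> x _; rewrite lee_fin !mulr_ge0 ?exprn_ge0.
  - exact: mA.
  - by move=> x _; rewrite lee_fin !mulr_ge0 ?exprn_ge0.
  - exact: mA.
have QD : (Q L + Q (~` L) = 1)%E.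
  rewrite probability_setC// addeC subeK//.
  by rewrite fin_num_measure.
have QCfin : Q (~` L) \is a fin_num by rewrite fin_num_measure//; exact: measurableC.
have := leeD2l (A L) (A_ge _ FLC); rewrite AD.
rewrite -[leRHS]mule1 -QD muleDr; last 2 first.
- by [].
- by rewrite ge0_adde_def// inE.
by rewrite leeD2rE// fin_numM.
Qed.

End TiltedRegular.

(** * The limit martingale and its measure *)

(** The sum of the [r ^ i] is [n] for [r = 1] and the exact quotient otherwise, which merges the two
    cases. *)
Lemma Bmart_tilted (R : realType) (p q : nat -> R) s n r tau : (0 < r)%N ->
  Bmart p q s n r tau = s ^+ Mn n tau * tilted p q s r ^- (\sum_(i < n) r ^ i)
    * (Zn n tau == r ^ n)%N%:R.
Proof.
move=> r_gt0.
have ind k : \1_[set t | Zn n t = k] tau = (Zn n tau == k)%:R :> R.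
  rewrite indicE; congr (nat_of_bool _)%:R.
  by apply/idP/eqP; rewrite inE.
rewrite /Bmart; case: eqVneq => [->|r1].
  rewrite exp1n ind; congr (_ * _ ^- _ * _).
  under eq_bigr do rewrite exp1n.
  by rewrite sum1_card card_ord.
rewrite ind; congr (_ * _ ^- _ * _).
rewrite !subn1 predn_exp mulKn//.
by case: r r_gt0 r1 {ind} => [|[]].
Qed.

Lemma expectation_Bmart (R : realType) (p q : nat -> R)
    (P : probability markedTree R) s n r L :
  0 <= s -> (0 < r)%N -> 0 < tilted p q s r -> Fn n L ->
  ('E_P[fun tau => (\1_L tau * Bmart p q s n r tau)%R] =
   (\int[P]_x (\1_L x * (s ^+ Mn n x * (Zn n x == r ^ n)%N%:R))%:E) *
   (tilted p q s r ^- (\sum_(i < n) r ^ i))%:E)%E.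
Proof.
move=> s_ge0 r_gt0 a_gt0 FL; rewrite unlock muleC -ge0_integralZl_EFin//.
- apply: eq_integral => x _; rewrite Bmart_tilted// -EFinM; congr (_%:E).
  by move: (_ ^- _) (s ^+ _) (_ %:R) (\1_L x) => *; ring.
- by move=> x _; rewrite lee_fin !mulr_ge0 ?exprn_ge0.
- exact: rdep_EFin_measurable
    (rdep_fun (s := s) (fun k => (k == r ^ n)%N%:R) FL (leqnn n)).
- by rewrite invr_ge0 exprn_ge0// ltW.
Qed.

(** The F_n increase, so their union is a generating system stable under intersection, on which both
    measures agree. *)
Lemma defines_Q_unique (R : realType) (P : probability markedTree R)
    (p q : nat -> R) s r (Q Q' : probability markedTree R) :
  defines_Q P p q s r Q -> defines_Q P p q s r Q' ->
  forall A, measurable A -> Q' A = Q A.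
Proof.
move=> QD QD' A mA.
have Fm B : Fgen B -> measurable B by move=> [n _]; exact: Fn_measurable.
apply: (@g_sigma_algebra_measure_unique _ _ _ Fgen Fm (fun=> setT)) => //.
- by move=> _; exists 0%N => //; apply/FnP.
- by rewrite bigcup_const.
- move=> B C [m _ FB] [n _ FC]; exists (maxn m n) => //.
  move: (Fn_mono (leq_maxl m n) FB) (Fn_mono (leq_maxr m n) FC) => /FnP BP /FnP CP.
  by apply/FnP => t t' E [Bt Ct]; split; [exact: BP Bt|exact: CP Ct].
- by move=> B [n _ FB]; rewrite [LHS](QD' _ _ FB) [RHS](QD _ _ FB).
- by move=> _; rewrite [X in (X < _)%E]probability_setT ltry.
Qed.

Section Offspring.
Context {R : realType} {p q : nat -> R} {s : R}.
Hypothesis p_offspring : is_offspring p.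
Hypothesis q01 : is_mark_function q.
Hypothesis s01 : 0 < s < 1.

Lemma tilted_le k : tilted p q s k <= p k.
Proof.
have [p_ge0 _] := p_offspring; rewrite ler_piMr//.
by have /andP[q0 q1] := q01 k; case/andP: s01 => s0 s1; nra.
Qed.

Lemma tilted_gt0 k : 0 < p k -> 0 < tilted p q s k.
Proof.
move=> pk; rewrite mulr_gt0//.
by have /andP[q0 q1] := q01 k; case/andP: s01 => s0 s1; nra.
Qed.

(** At [k0] the weight loses [(1 - s) * p k0 * q k0 > 0], and no other weight exceeds [p k];
    finiteness of the remaining sums keeps the inequality strict. *)
Lemma tilted_sum : (exists k, 0 < p k * q k) ->
  exists2 kappa, (\sum_(0 <= k <oo) (tilted p q s k)%:E = kappa%:E)%E & kappa < 1.
Proof.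
have [p_ge0 p_sum] := p_offspring; case/andP: s01 => s0 s1.
move=> [k0 pq_gt0].
have a_ge0 : forall k, 0 <= tilted p q s k.
  by apply: tilted_ge0 => //; exact: ltW.
pose rest (f : nat -> R) := (\sum_(0 <= k <oo | k != k0) (f k)%:E)%E.
have splitf (f : nat -> R) : (forall k, 0 <= f k) ->
    (\sum_(0 <= k <oo) (f k)%:E = (f k0)%:E + rest f)%E.
  by move=> f0; rewrite (@nneseriesD1 _ _ k0)// => k _; rewrite lee_fin.
have rest_le : (rest (tilted p q s) <= rest p)%E.
  apply: lee_nneseries => k _ *; rewrite lee_fin ?a_ge0//; exact: tilted_le.
have rest_ge0 : (0 <= rest (tilted p q s))%E.
  by apply: nneseries_ge0 => k _ _; rewrite lee_fin.
have restp_fin : rest p \is a fin_num.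
  rewrite ge0_fin_numE ?(le_trans rest_ge0)//.
  apply: (@le_lt_trans _ _ 1%E); last by rewrite ltry.
  by rewrite -p_sum (splitf p)// leeDr// lee_fin.
have resta_fin : rest (tilted p q s) \is a fin_num.
  rewrite ge0_fin_numE//; apply: le_lt_trans rest_le _.
  by rewrite ltey_eq restp_fin.
exists (tilted p q s k0 + fine (rest (tilted p q s))).
  by rewrite splitf// EFinD fineK.
rewrite -lte_fin EFinD fineK// -p_sum (splitf p)//.
apply: lte_leD => //; rewrite lte_fin /tilted /alpha.
move: pq_gt0; move: (p k0) (q k0) => x y; nra.
Qed.

Lemma offspring_ge2 : p 0%N + p 1%N < 1 -> exists2 k, (1 < k)%N & 0 < p k.
Proof.
have [p_ge0 p_sum] := p_offspring; move=> p01.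
apply: contrapT => nex.
have p_eq0 k : (1 < k)%N -> p k = 0.
  move=> k1; apply/eqP; rewrite eq_le p_ge0 andbT leNgt; apply/negP => pk.
  by apply: nex; exists k.
have : (\sum_(0 <= k <oo) (p k)%:E < 1)%E; last by rewrite p_sum ltxx.
rewrite (nneseries_split 0 2); last by move=> k _; rewrite lee_fin.
rewrite eseries0 ?adde0; last by move=> k k1 _; rewrite p_eq0.
by rewrite add0n big_nat_recr//= big_nat1 -EFinD lte_fin.
Qed.

End Offspring.

Unset Implicit Arguments.
Set Strict Implicit.
Set Printing Implicit Defensive.

Theorem theorem4p4 (R : realType) (l : nat) (p q : nat -> R)
    (P : probability markedTree R) (r : nat) (s t : R)
    (l_gt0 : (0 < l)%N)
    (p_offspring : is_offspring p)
    (p01 : p 0%N + p 1%N < 1)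
    (p0_eq0 : p 0%N = 0)
    (p_mean : has_moment p 1)
    (p_moment : has_moment p l)
    (q_mark : is_mark_function q)
    (pq_gt0 : exists k, 0 < p k * q k)
    (P_GW : is_marked_GW p q P)
    (pr_gt0 : 0 < p r)
    (r_min : forall k, 0 < p k -> (r <= k)%N)
    (s01 : 0 < s < 1)
    (t01 : 0 < t <= 1) :
  (forall (n : nat) (L : set markedTree), Fn n L ->
     ('E_P[fun tau => (\1_L tau * Hpoly l (Zn (n + m) tau)%:R
                       * s ^+ Mn (n + m) tau * t ^+ Zn (n + m) tau)%R]
      / 'E_P[fun tau => (Hpoly l (Zn (n + m) tau)%:R
                       * s ^+ Mn (n + m) tau * t ^+ Zn (n + m) tau)%R])%E
       @[m --> \oo] --> 'E_P[fun tau => (\1_L tau * Bmart p q s n r tau)%R]%E)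
  /\
  (exists Q : probability markedTree R,
     [/\ defines_Q P p q s r Q,
         forall Q' : probability markedTree R, defines_Q P p q s r Q' ->
           forall A, measurable A -> Q' A = Q A &
         is_marked_regular_tree r (s * q r / (s * q r + 1 - q r)) Q]).
Proof.
have [p_ge0 p_sum] := p_offspring.
have /andP[s0 s1] := s01; have s_ge0 : 0 <= s by exact: ltW.
have s_le : 0 <= s <= 1 by rewrite s_ge0 ltW.
have r_gt0 : (0 < r)%N.
  by case: r pr_gt0 {r_min} => //; rewrite p0_eq0 ltxx.
have a_min k : (k < r)%N -> tilted p q s k = 0.
  move=> kr; rewrite /tilted /alpha (_ : p k = 0) ?mul0r//.
  apply/eqP; rewrite eq_le p_ge0 andbT leNgt; apply/negP => /r_min.
  by rewrite leqNgt kr.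
have ar_gt0 : 0 < tilted p q s r by exact: (tilted_gt0 (p := p)).
have [kappa a_sum kappa_lt1] := tilted_sum p_offspring q_mark s01 pq_gt0.
have [k1 k1_gt1 pk1] := offspring_ge2 p_offspring p01.
have ak1_gt0 : 0 < tilted p q s k1 by exact: (tilted_gt0 (p := p)).
have sum_t : gensummable (tilted p q s) l (dilation t).
  apply: (@gensummable_dilation _ _ p) => //.
  - by case/andP: t01 => /ltW -> ->.
  - by rewrite /tilted /alpha p0_eq0 mul0r.
  - move=> k; rewrite (tilted_le p_offspring q_mark s01) andbT.
    exact: tilted_ge0.
split=> [n L FL|].
  rewrite expectation_Bmart//.
  have := limit_ratio p_ge0 q_mark P_GW s_le a_sum kappa_lt1 a_min r_gt0 ar_gt0
    k1_gt1 ak1_gt0 t01 sum_t l_gt0 FL.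
  apply: cvg_trans; apply: near_eq_cvg; apply: nearW => m /=.
  rewrite !unlock; congr (_ / _)%E; apply: eq_integral => x _; congr (_%:E);
    rewrite coef_dilationX Hpoly_bin; move: (s ^+ _) (t ^+ _) (_ %:R) => *; ring.
have [q0 q1] := andP (q_mark r).
pose den := s * q r + 1 - q r.
have den_gt0 : 0 < den by rewrite /den; nra.
set al := s * q r / _.
have al01 : 0 <= al <= 1.
  rewrite /al divr_ge0 ?(ltW den_gt0) ?mulr_ge0//=.
  by rewrite ler_pdivrMr// mul1r; lra.
(* [tilted p q s r] is [p r * den], the sum of a marked part [p r * s * q r] and an unmarked part
   [p r * (1 - q r)]; [al] is the marked share. *)
have al_weight (c : bool) : p0 p q r c * s ^+ c = tilted p q s r * bweight al c.
  rewrite /p0 /tilted /alpha /bweight /al; case: c => /=; rewrite ?expr1 ?expr0; field;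
    by rewrite gt_eqF.
have [Q Q_Phi] := @random_reg_tree_probability R al r.
have QD : defines_Q P p q s r Q.
  move=> n L FL; rewrite expectation_Bmart//.
  rewrite (integral_regular p_ge0 q_mark P_GW s_ge0 a_min r_gt0 al01 al_weight Q_Phi FL).
  by rewrite muleAC -EFinM mulfV ?mul1e// expf_neq0// gt_eqF.
exists Q; split=> // [Q' QD'|]; first exact: (defines_Q_unique QD QD').
exact: (random_reg_tree_marked_regular al01 Q_Phi).
Qed.
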